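(* For each positive integer $n$ and each prime $p>2n^2$, there is an isomorphism of graded $\mathbb{F}_p$-vector spaces $$H^*(cc^{\bullet}_{n,0})\cong H^*(cc^{\bullet}_{n,1}).$$
   Context: Let $Z_n=\{1,\dots,n\}$; second subscripts are read modulo $n$. For $\epsilon\in\mathbb{F}_p$, $\Lambda^{\bullet}_{n,\epsilon}$ is the differential graded $\mathbb{F}_p$-algebra $\Lambda_{\mathbb{F}_p}(h_{i,j}:i,j\in Z_n)$ with each $h_{i,j}$ in cohomological degree $1$ and $$d(h_{i,j})=\sum_{\ell=1}^{i-1}h_{\ell,j}h_{i-\ell,j+\ell}+\epsilon\sum_{\ell=i}^n h_{\ell,j}h_{i-\ell+n,j+\ell}.$$ It carries an additional internal grading valued in $\mathbb{Z}/2(p^n-1)\mathbb{Z}$, with $h_{i,j}$ in internal degree $2(p^i-1)p^j$, preserved by $d$. The critical complex $cc^{\bullet}_{n,\epsilon}\subseteq\Lambda^{\bullet}_{n,\epsilon}$ is the sub-DGA consisting of the elements of internal degree $0\in\mathbb{Z}/2(p^n-1)\mathbb{Z}$. Here ``graded'' refers to cohomological degree. *)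

(* Defs.v *)
From HB Require Import structures.
From mathcomp Require Import all_boot all_order all_algebra.
From mathcomp Require Import ring_quotient.
From mathcomp Require Import ring zify.

Set Implicit Arguments.
Unset Strict Implicit.
Unset Printing Implicit Defensive.

Import GRing.Theory.
Local Open Scope ring_scope.

Section VectorQuotient.
Variables (F : fieldType) (V : vectType F) (B : {vspace V}).

Definition vquot : Type := Quotient.quot (pred_of_vspace B).

HB.instance Definition _ := GRing.Zmodule.on vquot.

Definition vquot_proj : V -> vquot := (\pi_(Quotient.quot (pred_of_vspace B)))%qT.

Definition vquot_scale (a : F) (x : vquot) : vquot := vquot_proj (a *: repr x).

Lemma vquot_proj_eq x y : (vquot_proj x == vquot_proj y) = (x - y \in B).
Proof. by rewrite /vquot_proj -Quotient.idealrBE. Qed.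

Lemma vquot_projB : zmod_morphism vquot_proj.
Proof. exact: raddfB. Qed.

HB.instance Definition _ := GRing.isZmodMorphism.Build V vquot vquot_proj
  vquot_projB.

Lemma vquot_projK x : vquot_proj (repr x) = x.
Proof. exact: reprK. Qed.

Lemma vquot_proj_scale a x : vquot_scale a (vquot_proj x) = vquot_proj (a *: x).
Proof.
apply/eqP; rewrite vquot_proj_eq -scalerBr memvZ //.
by rewrite -vquot_proj_eq vquot_projK.
Qed.

Fact vquot_scaleA a b x :
  vquot_scale a (vquot_scale b x) = vquot_scale (a * b) x.
Proof.
by rewrite -[x]vquot_projK !vquot_proj_scale scalerA.
Qed.

Fact vquot_scale1 : left_id 1 vquot_scale.
Proof. by move=> x; rewrite /vquot_scale scale1r vquot_projK. Qed.

Fact vquot_scaleDr : right_distributive vquot_scale +%R.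
Proof.
move=> a x y; rewrite -[x]vquot_projK -[y]vquot_projK -raddfD.
by rewrite !vquot_proj_scale scalerDr raddfD.
Qed.

Fact vquot_scaleDl x : {morph vquot_scale^~ x : a b / a + b}.
Proof.
move=> a b; rewrite -[x]vquot_projK.
by rewrite !vquot_proj_scale scalerDl raddfD.
Qed.

HB.instance Definition _ := GRing.Zmodule_isLmodule.Build F vquot
  vquot_scaleA vquot_scale1 vquot_scaleDr vquot_scaleDl.

Fact vquot_proj_scalable : scalable vquot_proj.
Proof. by move=> a x; rewrite -vquot_proj_scale. Qed.

HB.instance Definition _ := GRing.isScalable.Build F V vquot *:%R vquot_proj
  vquot_proj_scalable.

End VectorQuotient.

Section Cohomology.
Variables (F : fieldType) (V : vectType F) (d : 'End(V)) (C : nat -> {vspace V}).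

Definition cocycles (k : nat) : {vspace V} := (C k :&: lker d)%VS.

Definition coboundaries (k : nat) : {vspace V} :=
  if k is k'.+1 then (d @: C k')%VS else 0%VS.

(* The coboundaries enter as a subspace of the vector space of cocycles, i.e.
   as their preimage under the inclusion of the latter into V. *)
Definition cohomology (k : nat) : lmodType F :=
  vquot (linfun (vsval : subvs_of (cocycles k) -> V) @^-1: coboundaries k)%VS.

End Cohomology.

Section ExteriorAlgebra.
Variables (F : fieldType) (I : finType).

(* x S is the coefficient of the product of the generators in S, taken in
   increasing order for the enumeration of I. *)
Definition ext : Type := {ffun {set I} -> F^o}.

HB.instance Definition _ := Vector.on ext.

Implicit Types (S T U : {set I}) (x y z : ext) (s t : I).

Definition before s t := (enum_rank s < enum_rank t)%N.

Definition inversions S T : nat := \sum_(s in S) \sum_(t in T) before t s.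

Definition ext_sign S T : F := (-1) ^+ inversions S T.

Definition ext_mono S : ext := [ffun U => (U == S)%:R].

Definition ext_mul x y : ext :=
  [ffun U : {set I} => \sum_(S : {set I} | S \subset U)
     ext_sign S (U :\: S) * (x S * y (U :\: S)) : F].

Lemma ext_signUl S T U : [disjoint S & T] ->
  ext_sign (S :|: T) U = ext_sign S U * ext_sign T U.
Proof.
move=> dST; rewrite /ext_sign -exprD /inversions -bigU //.
by congr (_ ^+ _); apply: eq_bigl => s; rewrite !inE.
Qed.

Lemma ext_signUr S T U : [disjoint T & U] ->
  ext_sign S (T :|: U) = ext_sign S T * ext_sign S U.
Proof.
move=> dTU; rewrite /ext_sign -exprD /inversions -big_split /=.
congr (_ ^+ _); apply: eq_bigr => s _; rewrite -bigU //.
by apply: eq_bigl => t; rewrite !inE.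
Qed.

Lemma ext_sign0l U : ext_sign set0 U = 1.
Proof. by rewrite /ext_sign /inversions big_set0. Qed.

Lemma ext_sign0r U : ext_sign U set0 = 1.
Proof. by rewrite /ext_sign /inversions big1 // => s _; rewrite big_set0. Qed.

Fact ext_mulA : associative ext_mul.
Proof.
move=> x y z; apply/ffunP=> U; rewrite !ffunE.
under eq_bigr => S _ do rewrite ffunE big_distrr big_distrr /=.
under [RHS]eq_bigr => W _ do rewrite ffunE big_distrl big_distrr /=.
rewrite pair_big_dep [RHS]pair_big_dep /=.
pose f (q : {set I} * {set I}) := (q.2, q.1 :\: q.2).
pose g (q : {set I} * {set I}) := (q.1 :|: q.2, q.1).
have E (W S : {set I}) : S \subset W -> S :|: W :\: S = W.
  by move=> SW; rewrite -[RHS](setID W S) (setIidPr SW).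
rewrite (reindex_onto f g) /=; last first.
  case=> S T /= /andP[_]; rewrite subsetD => /andP[_ dTS].
  by rewrite /f /g /= setDUl setDv set0U (setDidPl dTS).
apply: eq_big => [[W S]|[W S]] /=; rewrite /f /g /=.
  apply/idP/idP.
    case/andP=> /andP[SU WSU] /eqP[WE]; rewrite -WE subsetUl andbT.
    by rewrite subUset SU; apply: subset_trans WSU (subsetDl _ _).
  case/andP=> WU SW; rewrite (subset_trans SW WU) setSD //=.
  by rewrite E.
case/andP=> /andP[SU WSU] /eqP[WE].
have SW : S \subset W by rewrite -WE subsetUl.
have WU : W \subset U.
  by rewrite -WE subUset SU; apply: subset_trans WSU (subsetDl _ _).
have UE : U :\: S = (W :\: S) :|: (U :\: W).
  apply/setP=> i; rewrite !inE; move/subsetP/(_ i): SW; move/subsetP/(_ i): WU.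
  by case: (i \in S); case: (i \in W); case: (i \in U) => //= A B;
     (move: (A isT) || move: (B isT)).
have d1 : [disjoint W :\: S & U :\: W].
  by rewrite -setI_eq0; apply/eqP/setP=> i; rewrite !inE;
     case: (i \in W); rewrite ?andbF.
have d2 : [disjoint S & W :\: S].
  by rewrite -setI_eq0; apply/eqP/setP=> i; rewrite !inE;
     case: (i \in S); rewrite ?andbF.
have -> : ext_sign W (U :\: W) =
          ext_sign S (U :\: W) * ext_sign (W :\: S) (U :\: W).
  by rewrite -ext_signUl // E.
have -> : ext_sign S (U :\: S) = ext_sign S (W :\: S) * ext_sign S (U :\: W).
  by rewrite -ext_signUr // -UE.
rewrite setDDl E // !mulrA; congr (_ * _).
set a := ext_sign S (W :\: S); set b := ext_sign S (U :\: W).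
set c := ext_sign (W :\: S) (U :\: W).
move: (x S) (y (W :\: S)) a b c => u v a b c.
ring.
Qed.

Fact ext_mul1l : left_id (ext_mono set0) ext_mul.
Proof.
move=> x; apply/ffunP=> U; rewrite ffunE (bigD1 set0) ?sub0set //=.
rewrite big1 => [|S /andP[_ /negPf S0]]; last by rewrite ffunE S0 mul0r mulr0.
by rewrite addr0 ffunE eqxx mul1r setD0 ext_sign0l mul1r.
Qed.

Fact ext_mul1r : right_id (ext_mono set0) ext_mul.
Proof.
move=> x; apply/ffunP=> U; rewrite ffunE (bigD1 U) //=.
rewrite big1 => [|S /andP[SU SnU]]; last first.
  rewrite [X in _ * (_ * X)]ffunE setD_eq0.
  by rewrite eqEsubset SU /= in SnU; rewrite (negPf SnU) !mulr0.
by rewrite addr0 setDv ffunE eqxx mulr1 ext_sign0r mul1r.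
Qed.

Fact ext_mulDl : left_distributive ext_mul +%R.
Proof.
move=> x y z; apply/ffunP=> U; rewrite !ffunE -big_split /=.
by apply: eq_bigr => S _; rewrite ffunE mulrDl mulrDr.
Qed.

Fact ext_mulDr : right_distributive ext_mul +%R.
Proof.
move=> x y z; apply/ffunP=> U; rewrite !ffunE -big_split /=.
by apply: eq_bigr => S _; rewrite ffunE mulrDr mulrDr.
Qed.

Fact ext_mono_neq0 S : ext_mono S != 0.
Proof.
by apply/eqP => /ffunP/(_ S)/eqP; rewrite !ffunE eqxx oner_eq0.
Qed.

HB.instance Definition _ := GRing.Zmodule_isNzRing.Build ext
  ext_mulA ext_mul1l ext_mul1r ext_mulDl ext_mulDr (ext_mono_neq0 set0).

Fact ext_scaleAl (a : F) x y : a *: (x * y) = a *: x * y.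
Proof.
apply/ffunP=> U; rewrite !ffunE scaler_sumr.
apply: eq_bigr => S _; rewrite ffunE /GRing.scale /=.
by rewrite mulrCA -mulrA.
Qed.

HB.instance Definition _ := GRing.Lmodule_isLalgebra.Build F ext ext_scaleAl.

Fact ext_scaleAr (a : F) x y : a *: (x * y) = x * (a *: y).
Proof.
apply/ffunP=> U; rewrite !ffunE scaler_sumr.
apply: eq_bigr => S _; rewrite ffunE /GRing.scale /=.
by rewrite mulrCA; congr (_ * _); rewrite mulrCA.
Qed.

HB.instance Definition _ := GRing.Lalgebra_isAlgebra.Build F ext ext_scaleAr.

Definition ext_gen s : ext := ext_mono [set s].

(* The left partial derivative with respect to the generator of index s. *)
Definition ext_contr s x : ext :=
  [ffun U : {set I} => if s \in U then 0 else
     ext_sign [set s] U * x (s |: U) : F].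

Lemma ext_gen_mulE t x U :
  (ext_gen t * x) U =
    if t \in U then ext_sign [set t] (U :\ t) * x (U :\ t) else 0.
Proof.
rewrite ffunE; case: ifP => tU.
  rewrite (bigD1 [set t]) ?sub1set //= ffunE eqxx mul1r big1 ?addr0 //.
  by move=> S /andP[_ /negPf St]; rewrite ffunE St mul0r mulr0.
rewrite big1 // => S SU; rewrite ffunE.
by case: eqP => [SE|]; rewrite ?mul0r ?mulr0 //; rewrite SE sub1set tU in SU.
Qed.

Lemma ext_signss s : ext_sign [set s] [set s] = 1.
Proof. by rewrite /ext_sign /inversions !big_set1 /before ltnn. Qed.

Lemma ext_sign_sq S T : ext_sign S T * ext_sign S T = 1.
Proof. by rewrite /ext_sign -expr2 sqrr_sign. Qed.

Lemma ext_sign_anti s t : s != t ->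
  ext_sign [set s] [set t] = - ext_sign [set t] [set s].
Proof.
move=> st; rewrite /ext_sign /inversions !big_set1 /before.
have : enum_rank s != enum_rank t by rewrite (inj_eq enum_rank_inj).
rewrite -(inj_eq val_inj) /=.
by case: ltngtP => //= _ _; rewrite ?expr1 ?expr0 ?opprK.
Qed.

Lemma ext_gen_sq s : ext_gen s * ext_gen s = 0.
Proof.
apply/ffunP=> U; rewrite ext_gen_mulE !ffunE; case: ifP => // sU.
have -> : (U :\ s == [set s]) = false.
  by apply/eqP=> /setP/(_ s); rewrite !inE eqxx.
by rewrite mulr0.
Qed.

Lemma ext_gen_swap s t x : s != t ->
  ext_gen s * (ext_gen t * x) = - (ext_gen t * (ext_gen s * x)).
Proof.
move=> st; apply/ffunP=> U; rewrite [RHS]ffunE !ext_gen_mulE !inE.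
rewrite (eq_sym t s) st /=.
case: (boolP (s \in U)) => sU; case: (boolP (t \in U)) => tU;
  rewrite ?mulr0 ?oppr0 //.
have e : U :\ s :\ t = U :\ t :\ s by rewrite !setDDl setUC.
have e1 : U :\ s = t |: (U :\ s :\ t).
  by rewrite setD1K // !inE eq_sym st.
have e2 : U :\ t = s |: (U :\ s :\ t).
  by rewrite e setD1K // !inE st.
rewrite -e {1}e1 e2 !ext_signUr ?disjoints1 ?inE ?eqxx ?andbF //=.
by rewrite (ext_sign_anti st); ring.
Qed.

Lemma ext_gen_anti s t : ext_gen s * ext_gen t = - (ext_gen t * ext_gen s).
Proof.
have [->|st] := eqVneq s t; first by rewrite ext_gen_sq oppr0.
by rewrite -[ext_gen t in LHS]mulr1 (ext_gen_swap _ st) mulr1.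
Qed.

Lemma ext_contr_gen s t x :
  ext_contr s (ext_gen t * x) = (s == t)%:R *: x - ext_gen t * ext_contr s x.
Proof.
apply/ffunP=> U; rewrite [LHS]ffunE [RHS]ffunE [X in _ + X]ffunE.
rewrite [X in X + _]ffunE !ext_gen_mulE /GRing.scale /= [ext_contr _ _ _]ffunE.
have [<-|st] := eqVneq s t.
  rewrite mul1r; case: (boolP (s \in U)) => sU.
    rewrite !inE eqxx /= setD1K // mulrA ext_sign_sq mul1r subrr //.
  by rewrite setU11 subr0 setU1K // mulrA ext_sign_sq mul1r.
rewrite mul0r sub0r !inE [t == s]eq_sym !(negPf st) /=.
case: (boolP (s \in U)) => sU; first by case: ifP; rewrite ?mulr0 oppr0.
case: (boolP (t \in U)) => tU; last by rewrite mulr0 oppr0.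
have e : (s |: U) :\ t = s |: (U :\ t).
  by apply/setP=> i; rewrite !inE; case: (eqVneq i s) => [->|]; rewrite ?st.
rewrite e ext_signUr ?disjoints1 ?inE ?(negPf sU) ?andbF //.
rewrite -{1}(setD1K tU) ext_signUr ?disjoints1 ?inE ?eqxx //.
by rewrite (ext_sign_anti st); ring: (ext_sign_sq [set t] [set s]).
Qed.

Lemma ext_gen_mono s S : s \notin S ->
  ext_gen s * ext_mono S = ext_sign [set s] S *: ext_mono (s |: S).
Proof.
move=> sS; apply/ffunP=> U; rewrite [RHS]ffunE ext_gen_mulE !ffunE.
case: ifP => sU.
  case: (eqVneq (U :\ s) S) => [<-|US]; first by rewrite setD1K ?eqxx.
  case: eqP => [UE|_]; last by rewrite /GRing.scale /= !mulr0.
  by case/eqP: US; rewrite UE setU1K.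
by case: eqP => [UE|_]; rewrite ?scaler0 //; rewrite UE setU11 in sU.
Qed.

Lemma enum_before S : pairwise before (enum S).
Proof.
suff H : pairwise before (enum I).
  by rewrite /enum_mem pairwise_filter // -enumT.
case: (pickP I) => [x0 _|I0]; last first.
  by rewrite (_ : enum I = [::]) //; apply/size0nil; rewrite -cardE eq_card0.
apply/(pairwiseP x0) => i j; rewrite !inE -!cardE => li lj ij.
rewrite /before -(enum_val_nth x0 (Ordinal li)) -(enum_val_nth x0 (Ordinal lj)).
by rewrite !enum_valK.
Qed.

Lemma ext_monoE S : ext_mono S = \prod_(s <- enum S) ext_gen s.
Proof.
have : pairwise before (enum S) := enum_before S.
rewrite -{2}[S](set_enum S); elim: (enum S) => [|s w IHw] /=.
  by rewrite big_nil => _; congr ext_mono; apply/setP=> i; rewrite !inE //.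
case/andP=> sw /IHw; rewrite big_cons => <-.
have sNw : s \notin [set t | t \in w].
  rewrite inE; apply/negP => /(allP sw).
  by rewrite /before ltnn.
rewrite ext_gen_mono // /ext_sign /inversions big_set1 big1 => [|t]; last first.
  rewrite inE => /(allP sw); rewrite /before => st.
  by rewrite ltnNge ltnW.
by rewrite scale1r; congr ext_mono; apply/setP=> i; rewrite !inE.
Qed.

Lemma ext_sum x : x = \sum_S x S *: ext_mono S.
Proof.
apply/ffunP=> U; rewrite sum_ffunE (bigD1 U) //= big1 ?addr0 => [|S SU].
  by rewrite !ffunE eqxx /GRing.scale /= mulr1.
by rewrite !ffunE eq_sym (negPf SU) scaler0.
Qed.

Definition ext_deriv_fun (g : I -> ext) x : ext := \sum_s g s * ext_contr s x.

Fact ext_contr_linear s : linear (ext_contr s).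
Proof.
move=> a x y; apply/ffunP=> U; rewrite !ffunE.
case: ifP => _; first by rewrite scaler0 addr0.
by rewrite /GRing.scale /= mulrDr mulrCA.
Qed.

HB.instance Definition _ s := GRing.isLinear.Build F ext ext *:%R (ext_contr s)
  (ext_contr_linear s).

Fact ext_deriv_linear g : linear (ext_deriv_fun g).
Proof.
move=> a x y; rewrite /ext_deriv_fun scaler_sumr -big_split /=.
by apply: eq_bigr => s _; rewrite linearP mulrDr scalerAr.
Qed.

HB.instance Definition _ g := GRing.isLinear.Build F ext ext *:%R
  (ext_deriv_fun g) (ext_deriv_linear g).

(* For g with values in degree 2, the graded derivation whose value on the
   generator of index s is g s; see ext_deriv_gen and ext_leibniz. *)
Definition ext_deriv (g : I -> ext) : 'End(ext) := linfun (ext_deriv_fun g).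

Definition ext_span (P : pred {set I}) : {vspace ext} :=
  (\sum_(S : {set I} | P S) <[ext_mono S]>)%VS.

Lemma ext_mono_span (P : pred {set I}) S : P S -> ext_mono S \in ext_span P.
Proof. by move=> PS; rewrite memvE (sumv_sup S). Qed.

Lemma ext_spanP (P : pred {set I}) x :
  reflect (forall S, ~~ P S -> x S = 0) (x \in ext_span P).
Proof.
apply: (iffP idP) => [/memv_sumP[f fP ->] U PU|x0].
  rewrite sum_ffunE big1 // => S PS.
  have /vlineP[a ->] := fP S PS.
  rewrite !ffunE; case: eqP => [UE|_]; last by rewrite scaler0.
  by rewrite UE PS in PU.
rewrite (ext_sum x); apply: memv_suml => S _.
case: (boolP (P S)) => PS; last by rewrite x0 // scale0r mem0v.
by rewrite memvZ ?ext_mono_span.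
Qed.

Lemma ext_contr1 s : ext_contr s 1 = 0.
Proof.
apply/ffunP=> U; rewrite !ffunE; case: ifP => // sU.
have -> : (s |: U == set0) = false.
  by apply/eqP => /setP/(_ s); rewrite !inE eqxx.
by rewrite mulr0.
Qed.

Lemma ext_deriv1 g : ext_deriv g 1 = 0.
Proof.
by rewrite lfunE /= /ext_deriv_fun big1 // => s _; rewrite ext_contr1 mulr0.
Qed.

Definition ext_homog (k : nat) : {vspace ext} := ext_span (fun S => #|S| == k).

Lemma ext_span_ind (P : pred {set I}) (Q : ext -> Prop) :
  Q 0 -> (forall a x y, Q x -> Q y -> Q (a *: x + y)) ->
  (forall S, P S -> Q (ext_mono S)) -> forall x, x \in ext_span P -> Q x.
Proof.
move=> Q0 QD Qm x /ext_spanP xP; rewrite (ext_sum x).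
elim/big_ind: _ => //.
  by move=> y z Py Pz; rewrite -[y]scale1r; apply: QD.
move=> S _; case: (boolP (P S)) => PS; last by rewrite xP // scale0r.
by rewrite -[_ *: _]addr0; apply: QD => //; apply: Qm.
Qed.

Lemma ext_gen_comm s k x : x \in ext_homog k ->
  ext_gen s * x = (-1) ^+ k *: (x * ext_gen s).
Proof.
move: x; apply: (ext_span_ind (P := fun S => #|S| == k)) => [|a x y IHx IHy|S /= /eqP <-].
- by rewrite mulr0 mul0r scaler0.
- rewrite mulrDr IHy mulrDl scalerDr; congr (_ + _).
  by rewrite -scalerAr IHx -scalerAl !scalerA mulrC.
rewrite cardE ext_monoE; elim: (enum S) => [|t w IHw].
  by rewrite big_nil mulr1 mul1r scale1r.
rewrite big_cons [LHS]mulrA (ext_gen_anti s t) mulNr -[in LHS]mulrA IHw.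
by rewrite /= exprS mulN1r scaleNr -scalerAr mulrA.
Qed.

Lemma ext_spanM (P Q R : pred {set I}) x y :
  (forall S T, P S -> Q T -> [disjoint S & T] -> R (S :|: T)) ->
  x \in ext_span P -> y \in ext_span Q -> x * y \in ext_span R.
Proof.
move=> PQR /ext_spanP xP /ext_spanP yQ; apply/ext_spanP=> U RU.
rewrite ffunE big1 // => S SU.
case: (boolP (P S)) => PS; last by rewrite xP // mul0r mulr0.
case: (boolP (Q (U :\: S))) => QS; last by rewrite yQ // !mulr0.
have UE : S :|: (U :\: S) = U by rewrite -[RHS](setID U S) (setIidPr SU).
case/negP: RU; rewrite -UE; apply: PQR => //.
by rewrite -setI_eq0; apply/eqP/setP=> i; rewrite !inE; case: (i \in S).
Qed.

Lemma ext_span_contr (P Q : pred {set I}) s x :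
  (forall S, s \notin S -> P (s |: S) -> Q S) ->
  x \in ext_span P -> ext_contr s x \in ext_span Q.
Proof.
move=> PQ /ext_spanP xP; apply/ext_spanP=> U QU; rewrite ffunE.
case: ifPn => // sU; rewrite xP ?mulr0 //.
by apply/negP => /(PQ _ sU); rewrite (negPf QU).
Qed.

Lemma ext_gen_span (P : pred {set I}) s : P [set s] -> ext_gen s \in ext_span P.
Proof. exact: ext_mono_span. Qed.

Lemma ext_gen_homog s : ext_gen s \in ext_homog 1.
Proof. by apply: ext_gen_span; rewrite /= cards1. Qed.

Lemma ext_homogM k l x y : x \in ext_homog k -> y \in ext_homog l ->
  x * y \in ext_homog (k + l).
Proof.
apply: ext_spanM => S T /= /eqP <- /eqP <- dST.
by rewrite cardsU disjoint_setI0 // cards0 subn0.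
Qed.

Section Derivation.
Variable g : I -> ext.
Hypothesis g2 : forall s, g s \in ext_homog 2.

Lemma ext_deriv_genM t x :
  ext_deriv g (ext_gen t * x) = g t * x - ext_gen t * ext_deriv g x.
Proof.
rewrite !lfunE /= /ext_deriv_fun mulr_sumr.
under eq_bigr => s _ do rewrite ext_contr_gen mulrBr mulrA.
rewrite big_split /= sumrN; congr (_ - _).
  rewrite (bigD1 t) //= eqxx scale1r big1 ?addr0 // => s /negPf ->.
  by rewrite scale0r mulr0.
apply: eq_bigr => s _.
by rewrite mulrA (ext_gen_comm _ (g2 s)) sqrrN expr1n scale1r.
Qed.

Lemma ext_deriv_gen t : ext_deriv g (ext_gen t) = g t.
Proof.
by rewrite -[ext_gen t]mulr1 ext_deriv_genM ext_deriv1 mulr0 subr0 mulr1.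
Qed.

Lemma ext_leibniz k x y : x \in ext_homog k ->
  ext_deriv g (x * y) =
    ext_deriv g x * y + (-1) ^+ k *: (x * ext_deriv g y).
Proof.
move: x; apply: (ext_span_ind (P := fun S => #|S| == k)) => [|a x z IHx IHz|S /= /eqP <-].
- by rewrite mul0r linear0 !mul0r scaler0 addr0.
- rewrite mulrDl -scalerAl !(linearP (ext_deriv g)) /= IHx IHz !mulrDl -!scalerAl !scalerDr.
  by rewrite addrACA !scalerA [_ * a]mulrC.
rewrite cardE ext_monoE; elim: (enum S) => [|t w IHw].
  by rewrite big_nil !mul1r ext_deriv1 mul0r add0r scale1r.
rewrite big_cons -mulrA !ext_deriv_genM IHw mulrDr mulrBl opprD addrA !mulrA.
by rewrite /= exprS mulN1r scaleNr -scalerAr mulrA.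
Qed.

Lemma ext_deriv_sq0 :
  (forall s, ext_deriv g (g s) = 0) -> forall x, ext_deriv g (ext_deriv g x) = 0.
Proof.
move=> g0 x; rewrite (ext_sum x) !linear_sum big1 // => S _ /=.
rewrite !linearZ /= ext_monoE; apply/eqP; rewrite scaler_eq0; apply/orP; right.
apply/eqP; elim: (enum S) => [|t w IHw]; first by rewrite big_nil ext_deriv1 linear0.
rewrite big_cons ext_deriv_genM linearB /= ext_deriv_genM.
rewrite (ext_leibniz _ (g2 t)) g0 mul0r add0r sqrrN expr1n scale1r.
by rewrite opprB addrCA subrr addr0 IHw mulr0.
Qed.

End Derivation.
End ExteriorAlgebra.

Section CriticalComplex.
Variables (F : fieldType) (n p : nat).

(* The index (i, j) stands for the generator h_(i+1, j+1). *)
Local Notation index := ('I_n * 'I_n)%type.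
Local Notation Lambda := (ext F index).

(* The generator h_(i, j), for 1 <= i <= n and for j read modulo n. *)
Definition hgen (i j : nat) : Lambda :=
  \sum_(s : index | (s.1.+1 == i) && (s.2.+1 == j %[mod n])) ext_gen F s.

(* Subtraction on nat is truncated: i - l + n is written i + n - l. *)
Definition dLambda_gen (eps : F) (s : index) : Lambda :=
  let i := s.1.+1 in let j := s.2.+1 in
  \sum_(1 <= l < i) hgen l j * hgen (i - l) (j + l)
  + eps *: \sum_(i <= l < n.+1) hgen l j * hgen (i + n - l) (j + l).

Definition dLambda (eps : F) : 'End(Lambda) := ext_deriv (dLambda_gen eps).

Definition gen_ideg (s : index) : nat := (2 * (p ^ s.1.+1 - 1) * p ^ s.2.+1)%N.

Definition mono_ideg (S : {set index}) : nat := (\sum_(s in S) gen_ideg s)%N.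

Definition ideg_modulus : nat := (2 * (p ^ n - 1))%N.

Definition bidegree (k c : nat) : {vspace Lambda} :=
  ext_span F
    (fun S => (#|S| == k) && (mono_ideg S == c %[mod ideg_modulus])).

Definition cc (k : nat) : {vspace Lambda} := bidegree k 0.

Lemma hgenE (s : index) : hgen s.1.+1 s.2.+1 = ext_gen F s.
Proof.
rewrite /hgen (bigD1 s) ?eqxx //= big1 ?addr0 // => t /andP[/andP[/eqP[e1] e2] ts].
case/eqP: ts; rewrite [t]surjective_pairing [s]surjective_pairing.
congr pair; apply: val_inj => //=.
move: e2; rewrite -addn1 -[s.2.+1]addn1 eqn_modDr.
by rewrite !modn_small // => /eqP.
Qed.

Lemma hgen_mod i j j' : j = j' %[mod n] -> hgen i j = hgen i j'.
Proof. by move=> e; rewrite /hgen; apply: eq_bigl => s; rewrite e. Qed.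

Lemma hgen_homog i j : hgen i j \in ext_homog F _ 1.
Proof. by apply: memv_suml => s _; apply: ext_gen_homog. Qed.

Lemma dLambda_gen_homog eps s : dLambda_gen eps s \in ext_homog F _ 2.
Proof.
rewrite memvD ?memvZ //; apply: memv_suml => l _;
by rewrite (ext_homogM (hgen_homog _ _) (hgen_homog _ _)).
Qed.

Lemma dLambda_hgen eps i j : (1 <= i <= n)%N ->
  dLambda eps (hgen i j) =
    \sum_(1 <= l < i) hgen l j * hgen (i - l) (j + l)
    + eps *: \sum_(i <= l < n.+1) hgen l j * hgen (i + n - l) (j + l).
Proof.
case/andP=> i0 lin; have n0 : (0 < n)%N by apply: leq_trans lin.
have li : (i.-1 < n)%N by rewrite prednK.
have lj : ((j + n.-1) %% n < n)%N by rewrite ltn_pmod.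
pose s : index := (Ordinal li, Ordinal lj).
have s1 : s.1.+1 = i by rewrite /= prednK.
have s2 : s.2.+1 = j %[mod n].
  by rewrite /= -addn1 modnDml -addnA addn1 prednK // modnDr.
rewrite -(hgen_mod _ s2) -{1}s1 hgenE /dLambda ext_deriv_gen; last exact: dLambda_gen_homog.
rewrite /dLambda_gen s1.
have E l i' : hgen l s.2.+1 * hgen i' (s.2.+1 + l) = hgen l j * hgen i' (j + l).
  have e : s.2.+1 + l = j + l %[mod n] by rewrite -modnDml s2 modnDml.
  by rewrite (hgen_mod _ s2) (hgen_mod _ e).
under eq_bigr => l _ do rewrite E.
by under [X in _ + _ *: X]eq_bigr => l _ do rewrite E.
Qed.

Lemma dLambda_leibniz eps k x y : x \in ext_homog F index k ->
  dLambda eps (x * y) = dLambda eps x * y + (-1) ^+ k *: (x * dLambda eps y).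
Proof. by move=> xk; apply: ext_leibniz xk; apply: dLambda_gen_homog. Qed.

Let c (eps : F) l i : F := if (l < i)%N then 1 else eps.
Let r i l : nat := if (l < i)%N then (i - l)%N else (i + n - l)%N.

Let dLambda_hgenE eps i j : (1 <= i <= n)%N ->
  dLambda eps (hgen i j) = \sum_(1 <= l < n.+1) c eps l i *: (hgen l j * hgen (r i l) (j + l)).
Proof.
move=> hi; rewrite dLambda_hgen // [RHS](big_cat_nat _ (n := i)) //=; try lia.
congr (_ + _); last rewrite scaler_sumr; apply: eq_big_nat => l hl;
  rewrite /c /r; case: ltnP => ?; rewrite ?scale1r //; lia.
Qed.

Lemma dLambda_sq0 eps x : dLambda eps (dLambda eps x) = 0.
Proof.
apply: ext_deriv_sq0; first exact: dLambda_gen_homog.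
case=> i0 j0; rewrite -(ext_deriv_gen (dLambda_gen_homog eps)) -hgenE /=.
have : (1 <= i0.+1 <= n)%N by rewrite /= ltn_ord.
move: i0.+1 j0.+1 => i j hi {i0 j0}; rewrite -[ext_deriv _]/(dLambda eps).
have rP i' l : (1 <= i' <= n)%N -> (1 <= l <= n)%N -> (1 <= r i' l <= n)%N.
  by rewrite /r; case: (ltnP l i'); lia.
rewrite dLambda_hgenE // linear_sum /=.
under eq_big_nat => l hl.
  rewrite linearZ /= (dLambda_leibniz _ _ (hgen_homog _ _)) expr1 scaleN1r.
  rewrite (dLambda_hgenE _ _ hl) dLambda_hgenE ?rP // mulr_suml mulr_sumr.
  over.
under eq_bigr => l _ do rewrite scalerBr !scaler_sumr.
rewrite sumrB exchange_big /=; apply/eqP; rewrite subr_eq0; apply/eqP.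
apply: eq_big_nat => m hm.
pose s q := if (q + m <= n)%N then (q + m)%N else (q + m - n)%N.
pose t l := r l m.
have tP l : (1 <= l <= n)%N -> s (t l) = l.
  by rewrite /s /t /r; case: (ltnP m l) => ?; case: ifP => ?; lia.
have sP q : (1 <= q <= n)%N -> t (s q) = q.
  by rewrite /s /t /r; case: (leqP (q + m) n) => ?; case: ifP => ?; lia.
have sR q : (1 <= q <= n)%N -> (1 <= s q <= n)%N.
  by rewrite /s; case: ifP => ?; lia.
rewrite (perm_big (map s (index_iota 1 n.+1))) /=; last first.
  apply: uniq_perm; first exact: iota_uniq.
    rewrite map_inj_in_uniq ?iota_uniq // => q q'.
    by rewrite !mem_index_iota !ltnS => /sP e /sP e' ee; rewrite -e ee e'.
  move=> l; rewrite mem_index_iota ltnS; apply/idP/mapP.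
    move=> hl; exists (t l); last by rewrite tP.
    by rewrite mem_index_iota ltnS; apply: rP.
  by case=> q; rewrite mem_index_iota ltnS => /sR hq ->.
rewrite big_map; apply: eq_big_nat => q hq.
rewrite -scalerAl -scalerAr !scalerA mulrA; congr (_ *: (_ * _ * _)).
- rewrite /c /s /r; case: (leqP (q + m) n) => ?; case: (ltnP m i) => ?;
    do ?case: ifP => ?; rewrite ?mul1r ?mulr1 //; lia.
- congr (hgen _ _); rewrite -[RHS](sP q hq) //.
- have -> : r i (s q) = r (r i m) q.
    rewrite /s /r; case: (leqP (q + m) n) => ?; case: (ltnP m i) => ?;
    by do ?case: ifP => ?; lia.
  apply: hgen_mod; rewrite /s; case: ifP => ?; first by congr (_ %% _)%N; lia.
  have -> : (j + m + q = j + (q + m - n) + n)%N by lia.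
  by rewrite modnDr.
Qed.

Lemma bidegree_mod k a b : a = b %[mod ideg_modulus] ->
  bidegree k a = bidegree k b.
Proof. by move=> ab; rewrite /bidegree /ext_span; apply: eq_bigl => S; rewrite ab. Qed.

Lemma bidegreeM k l a b x y : x \in bidegree k a -> y \in bidegree l b ->
  x * y \in bidegree (k + l) (a + b).
Proof.
apply: ext_spanM => S T /andP[/eqP <- /eqP Sc] /andP[/eqP <- /eqP Te] dST.
rewrite cardsU disjoint_setI0 // cards0 subn0 eqxx /=.
rewrite -modnDm -Sc -Te modnDm; apply/eqP; congr (_ %% _)%N.
by rewrite /mono_ideg -bigU //; apply: eq_bigl => t; rewrite !inE.
Qed.

Lemma cc_mul k l x y : x \in cc k -> y \in cc l -> x * y \in cc (k + l).
Proof. exact: bidegreeM. Qed.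

Lemma cc_one : 1 \in cc 0.
Proof. by apply: ext_mono_span; rewrite cards0 /mono_ideg big_set0 !eqxx. Qed.

Hypothesis p_gt0 : (0 < p)%N.

Lemma expn_mod j j' : j = j' %[mod n] -> (p ^ j = p ^ j' %[mod p ^ n - 1])%N.
Proof.
have H : (p ^ n = 1 %[mod p ^ n - 1])%N.
  by rewrite -{1}(@subnK 1 (p ^ n)%N) ?expn_gt0 ?p_gt0 // modnDl.
have E i : (p ^ i = p ^ (i %% n) %[mod p ^ n - 1])%N.
  rewrite {1}(divn_eq i n) (mulnC (i %/ n)%N) expnD expnM mulnC -modnMmr.
  by rewrite -(modnXm (i %/ n)%N _ (p ^ n)%N) H modnXm exp1n modnMmr muln1.
by rewrite E => ->; rewrite -E.
Qed.

Lemma hgen_bidegree i j : hgen i j \in bidegree 1 (2 * (p ^ i - 1) * p ^ j)%N.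
Proof.
apply: memv_suml => s /andP[/eqP <- /eqP e]; apply: ext_gen_span.
rewrite cards1 /= /mono_ideg big_set1 /gen_ideg /ideg_modulus.
rewrite -!mulnA -!muln_modr eqn_mul2l /=.
by rewrite -modnMmr (expn_mod e) modnMmr.
Qed.

Lemma dLambda_gen_bidegree eps s : dLambda_gen eps s \in bidegree 2 (gen_ideg s).
Proof.
have H l i' : (l + i' = s.1.+1 %[mod n])%N ->
    hgen l s.2.+1 * hgen i' (s.2.+1 + l) \in bidegree 2 (gen_ideg s).
  move=> e; have := bidegreeM (hgen_bidegree l s.2.+1) (hgen_bidegree i' (s.2.+1 + l)).
  suff E : (2 * (p ^ l - 1) * p ^ s.2.+1 + 2 * (p ^ i' - 1) * p ^ (s.2.+1 + l)
            = gen_ideg s %[mod ideg_modulus])%N by rewrite (bidegree_mod _ E).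
  rewrite /gen_ideg /ideg_modulus -!mulnA -mulnDr -!muln_modr; congr (_ * _)%N.
  set J := s.2.+1; apply/eqP; rewrite -(eqn_modDr (p ^ J)%N); apply/eqP.
  have pX m : (0 < p ^ m)%N by rewrite expn_gt0 p_gt0.
  have -> : ((p ^ l - 1) * p ^ J + (p ^ i' - 1) * p ^ (J + l) + p ^ J
             = p ^ (l + i') * p ^ J)%N.
    rewrite !mulnBl !mul1n !expnD.
    have := leq_pmull (p ^ J)%N (pX l); have := leq_pmull (p ^ J * p ^ l)%N (pX i').
    by rewrite (mulnC (p ^ J)%N) mulnA (mulnC (p ^ i')%N); lia.
  rewrite mulnBl mul1n subnK ?leq_pmull //.
  by rewrite -modnMml (expn_mod e) modnMml.
rewrite memvD ?memvZ //; rewrite big_nat; apply: memv_suml => l hl; apply: H.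
  by congr (_ %% _)%N; lia.
by rewrite -(modnDr s.1.+1); congr (_ %% _)%N; have := ltn_ord s.1; lia.
Qed.

Lemma dLambda_bidegree eps k a x : x \in bidegree k a ->
  dLambda eps x \in bidegree k.+1 a.
Proof.
move=> xk; rewrite /dLambda lfunE /=; apply: memv_suml => s _.
pose Q (U : {set index}) :=
  (#|U|.+1 == k) && (gen_ideg s + mono_ideg U == a %[mod ideg_modulus]).
have xQ : ext_contr s x \in ext_span F Q.
  apply: ext_span_contr xk => U sU.
  by rewrite /Q cardsU1 sU /mono_ideg big_setU1.
apply: ext_spanM (dLambda_gen_bidegree eps s) xQ => S T.
case/andP=> /eqP Sc /eqP Sd /andP[/eqP Tc /eqP Td] dST.
rewrite cardsU disjoint_setI0 // cards0 subn0 Sc -Tc eqxx /=.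
rewrite -Td -modnDml -Sd modnDml; apply/eqP; congr (_ %% _)%N.
by rewrite /mono_ideg -bigU //; apply: eq_bigl => t; rewrite !inE.
Qed.

Lemma cc_dLambda eps k x : x \in cc k -> dLambda eps x \in cc k.+1.
Proof. exact: dLambda_bidegree. Qed.

Lemma cc_coboundaries eps k :
  (coboundaries (dLambda eps) cc k <= cocycles (dLambda eps) cc k)%VS.
Proof.
case: k => [|k] /=; first exact: sub0v.
apply/subvP => _ /memv_imgP[x xk ->].
by rewrite memv_cap cc_dLambda //= memv_ker dLambda_sq0.
Qed.

End CriticalComplex.

(* eps enters the differential only: the underlying space of cc is the same for
   all eps. *)
Definition Hcc (n p : nat) (eps : 'F_p) (k : nat) : lmodType 'F_p :=
  cohomology (dLambda n eps) (cc _ n p) k.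

(* Main.v *)
(* Over F_p, Lambda_(n,1) is the Chevalley-Eilenberg complex of gl_n: writing x_ab
   for the generator h_(i,j) with a = j and b = i + j modulo n, its differential is
   x_ab |-> sum_c x_ac x_cb, and that of Lambda_(n,0) keeps the terms for which the
   indices wind around Z/n no more than needed. Since p is large, cc is the part of
   weight zero for the diagonal torus. Call x_ab up if a < b and down if a > b, and
   filter cc by the number of up minus the number of down generators. On cc the
   differentials d_0 and d_1 differ by terms that lower the filtration by one, d_0
   raises it by at most one, and the leading part of d_0 turns out to be exact
   except in filtration degree zero. Hence both complexes are quasi-isomorphic,
   through a canonical truncation, to one and the same subquotient, and their
   cohomology groups have equal dimensions.

   For the exactness, a further filtration, by height, reduces d_0 to the
   differential of the Lie algebra of strictly upper triangular matrices, acting on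
   the up generators only. A set of up generators is a tournament; its weight is
   recorded by the scores of the n players. The balance of weights forces equal
   numbers of up and down generators as soon as the scores are distinct. When two
   scores agree, the corresponding weight space is acyclic: sl_2 theory for two
   neighbouring indices settles the case of two neighbouring equal scores, and shows
   that exchanging two neighbouring scores preserves acyclicity (as in Bott's
   theorem). *)
Require Import Defs.
From HB Require Import structures.
From mathcomp Require Import all_boot all_order all_algebra.
From mathcomp Require Import perm.
From mathcomp Require Import ring zify.

Set Implicit Arguments.
Unset Strict Implicit.
Unset Printing Implicit Defensive.

Import Order.TTheory GRing.Theory Num.Theory.
Local Open Scope ring_scope.

(** * Deformations of filtered complexes *)

Section QuotientTransfer.
Variables (F : fieldType) (r : nat).

(** For [C] a complement of [B] with basis [X]: the projection to [C] along [B], followed by the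
    linear map that carries [X] to [Y]. It kills [B], hence descends to the quotient. *)
Definition basis_transfer (V W : vectType F) (B C : {vspace V})
    (X : r.-tuple V) (Y : r.-tuple W) (v : V) : W :=
  \sum_(i < r) coord X i (daddv_pi C B v) *: Y`_i.

Fact basis_transfer_linear (V W : vectType F) B C X Y :
  linear (@basis_transfer V W B C X Y).
Proof.
move=> a u v; rewrite /basis_transfer scaler_sumr -big_split /=.
by apply: eq_bigr => i _; rewrite !linearP scalerDl scalerA.
Qed.

HB.instance Definition _ (V W : vectType F) B C X Y := GRing.isLinear.Build F V W *:%R
  (@basis_transfer V W B C X Y) (@basis_transfer_linear V W B C X Y).

Lemma basis_transfer0 (V W : vectType F) (B C : {vspace V}) (X : r.-tuple V)
    (Y : r.-tuple W) v :
  (B :&: C = 0)%VS -> v \in B -> basis_transfer B C X Y v = 0.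
Proof.
move=> BC vB; rewrite /basis_transfer big1 // => i _.
have BC' : (C :&: B = 0)%VS by rewrite capvC.
have -> : daddv_pi C B v = 0.
  have := daddv_pi_add BC' (subvP (addvSr C B) _ vB).
  by rewrite (daddv_pi_id BC) // => /(canRL (addrK _)); rewrite subrr.
by rewrite linear0 scale0r.
Qed.

Lemma basis_transferK (V W : vectType F) (B C : {vspace V}) (X : r.-tuple V)
    (D E : {vspace W}) (Y : r.-tuple W) v :
  (B :&: C = 0)%VS -> (B + C = fullv)%VS -> basis_of C X ->
  (D :&: E = 0)%VS -> basis_of E Y ->
  v - basis_transfer D E Y X (basis_transfer B C X Y v) \in B.
Proof.
move=> BC BCf bX DE bY.
have BC' : (C :&: B = 0)%VS by rewrite capvC.
have DE' : (E :&: D = 0)%VS by rewrite capvC.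
set w := basis_transfer B C X Y v.
have wE : w \in E.
  rewrite /w memv_suml // => i _; rewrite memvZ // -(span_basis bY) memv_span //.
  by rewrite mem_nth // size_tuple.
have -> : basis_transfer D E Y X w = daddv_pi C B v.
  rewrite [RHS](coord_basis bX (memv_pi _ _ _)) {1}/basis_transfer.
  apply: eq_bigr => i _; congr (_ *: _).
  by rewrite daddv_pi_id // /w /basis_transfer coord_sum_free ?(basis_free bY).
have vCB : v \in (C + B)%VS by rewrite addvC BCf memvf.
by rewrite -{1}(daddv_pi_add BC' vCB) addrC addKr memv_pi.
Qed.

End QuotientTransfer.

(** The hypothesis says that [B] and [D] have equal codimension, without truncated subtraction. The
    isomorphism matches bases of two complements. *)
Lemma vquot_isom (F : fieldType) (V W : vectType F) (B : {vspace V})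
    (D : {vspace W}) : (\dim {:V} + \dim D = \dim {:W} + \dim B)%N ->
  {f : {linear vquot B -> vquot D} | bijective f}.
Proof.
move=> eqd; set C := (B^C)%VS; set E := (D^C)%VS.
have BC : (B :&: C = 0)%VS by apply: capv_compl.
have DE : (D :&: E = 0)%VS by apply: capv_compl.
have BCf : (B + C = fullv)%VS by apply: addv_complf.
have DEf : (D + E = fullv)%VS by apply: addv_complf.
have dimE : \dim E = \dim C.
  move: eqd; rewrite -BCf -DEf !dimv_disjoint_sum //; lia.
have [Y bY] : {Y : (\dim C).-tuple W | basis_of E Y}.
  by rewrite -dimE; exists (vbasis E); apply: vbasisP.
have bX := vbasisP C; set X := vbasis C in bX.
pose g := basis_transfer B C X Y; pose h := basis_transfer D E Y X.
pose f (x : vquot B) := vquot_proj D (g (repr x)).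
pose f' (x : vquot D) := vquot_proj B (h (repr x)).
have gB v v' : v - v' \in B -> g v = g v'.
  by move=> /(basis_transfer0 X Y BC)/eqP; rewrite linearB subr_eq0 => /eqP.
have hD v v' : v - v' \in D -> h v = h v'.
  by move=> /(basis_transfer0 Y X DE)/eqP; rewrite linearB subr_eq0 => /eqP.
have fE v : f (vquot_proj B v) = vquot_proj D (g v).
  congr vquot_proj; apply: gB; rewrite -vquot_proj_eq.
  by rewrite vquot_projK.
have f'E v : f' (vquot_proj D v) = vquot_proj B (h v).
  congr vquot_proj; apply: hD; rewrite -vquot_proj_eq.
  by rewrite vquot_projK.
have lf : linear f.
  move=> a x y; rewrite -(vquot_projK x) -(vquot_projK y) -linearP !fE -linearP.
  by rewrite -linearP.
pose fL := GRing.isLinear.Build F _ _ *:%R f lf.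
exists (HB.pack_for {linear vquot B -> vquot D} f fL); exists f' => x /=.
  rewrite -(vquot_projK x) fE f'E; apply/eqP; rewrite eq_sym vquot_proj_eq.
  exact: basis_transferK.
rewrite -(vquot_projK x) f'E fE; apply/eqP; rewrite eq_sym vquot_proj_eq.
exact: basis_transferK.
Qed.

Lemma cohomology_isom (F : fieldType) (V : vectType F) (d d' : 'End(V))
    (C : nat -> {vspace V}) k :
  (coboundaries d C k <= cocycles d C k)%VS ->
  (coboundaries d' C k <= cocycles d' C k)%VS ->
  (\dim (cocycles d C k) + \dim (coboundaries d' C k)
   = \dim (cocycles d' C k) + \dim (coboundaries d C k))%N ->
  {f : {linear cohomology d C k -> cohomology d' C k} | bijective f}.
Proof.
(* The coboundaries enter [cohomology] as their preimage under the inclusion of the cocycles;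
   injectivity of the inclusion preserves their dimension. *)
have dimpre (Z B : {vspace V}) : (B <= Z)%VS ->
    \dim (linfun (vsval : subvs_of Z -> V) @^-1: B)%VS = \dim B.
  move=> BZ; set f := linfun _.
  have kf : lker f == 0%VS.
    by apply/lker0P => u v; rewrite !lfunE; apply: val_inj.
  rewrite -(limg_dim_eq (f := f)); last by rewrite (eqP kf) capv0.
  rewrite lpreimK // (subv_trans BZ) //; apply/subvP => v vZ.
  by rewrite -(vsprojK vZ); apply/memv_imgP; exists (vsproj Z v); rewrite ?memvf ?lfunE.
move=> BZ BZ' e; apply: vquot_isom.
by rewrite !dimpre // !dimvf.
Qed.

(** * The subquotient that carries the cohomology of a filtered complex *)

Section FilteredComplex.
Variables (F : fieldType) (V : vectType F) (d : 'End(V)).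
Variables (Fil : int -> int -> {vspace V}) (N : nat).
Hypothesis dd : forall x, d (d x) = 0.
Hypothesis FilS : forall k m m' : int, m <= m' -> (Fil k m <= Fil k m')%VS.
Hypothesis FilT : forall k m, (Fil k m <= Fil k N)%VS.
Hypothesis FilN : forall k, Fil k (- N%:Z) = 0%VS.
Hypothesis dFil : forall (k m : int) x, x \in Fil k m -> d x \in Fil (k + 1) (m + 1).
(** The leading part of [d], which raises the filtration by one, is exact on the associated graded
    space outside degree 0. *)
Hypothesis gr_exact : forall (k m : int) x, m != 0 -> x \in Fil k m ->
  d x \in Fil (k + 1) m ->
  exists2 y, y \in Fil (k - 1) (m - 1) & x - d y \in Fil k (m - 1).

(** [trunc] is the largest subcomplex inside filtration 0, [trunc_bd] the smallest one containing
    filtration -1. The [gr0] spaces are the preimages in [trunc] of the cocycles and coboundaries of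
    the quotient complex. *)
Definition trunc k := (Fil k 0 :&: d @^-1: Fil (k + 1) 0)%VS.
Definition trunc_bd k := (Fil k (- 1) + d @: Fil (k - 1) (- 1))%VS.
Definition gr0_cocycles k := (trunc k :&: d @^-1: trunc_bd (k + 1))%VS.
Definition gr0_coboundaries k := (d @: trunc (k - 1) + trunc_bd k)%VS.

Lemma truncP k x :
  reflect (x \in Fil k 0 /\ d x \in Fil (k + 1) 0) (x \in trunc k).
Proof. by rewrite memv_cap -memv_preim; apply: andP. Qed.

Lemma trunc_bdP k x : reflect
  (exists u v, [/\ u \in Fil k (-1), v \in Fil (k - 1) (-1) & x = u + d v])
  (x \in trunc_bd k).
Proof.
apply: (iffP memv_addP) => [[u uF [_ /memv_imgP[v vF ->] ->]]|[u [v [uF vF ->]]]].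
  by exists u, v.
by exists u => //; exists (d v) => //; apply: memv_img.
Qed.

Let dFil' (k m : int) x : x \in Fil (k - 1) m -> d x \in Fil k (m + 1).
Proof. by move/dFil; rewrite subrK. Qed.

Let FilW (k m m' : int) x : m <= m' -> x \in Fil k m -> x \in Fil k m'.
Proof. by move/FilS/subvP; apply. Qed.

Lemma trunc_bd_sub k : (trunc_bd k <= trunc k)%VS.
Proof.
apply/subvP => _ /trunc_bdP[u [v [uF vF ->]]]; apply/truncP; split.
  by rewrite memvD //; [exact: FilW uF | apply: dFil' vF].
by rewrite linearD /= dd addr0; apply: dFil uF.
Qed.

(** Exactness in the degrees m, ..., 1 removes the leading term of a cocycle one step at a time. *)
Lemma closed_lower k (m : nat) x : x \in Fil k m -> d x = 0 ->
  exists2 y, y \in Fil (k - 1) m & x - d y \in Fil k 0.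
Proof.
elim: m x => [|m IHm] x xF dx.
  by exists 0; rewrite ?mem0v // [d 0]linear0 subr0.
have m0 : (m.+1 : int) != 0 by [].
have [|y] := gr_exact m0 xF; first by rewrite dx mem0v.
rewrite -addn1 PoszD addrK => yF xyF.
case: (IHm _ xyF) => [|z zF xyz]; first by rewrite linearB /= dx dd subrr.
exists (y + z); last by rewrite linearD opprD addrA.
by rewrite memvD //; [apply: FilW yF | apply: FilW zF]; lia.
Qed.

(** Exactness in negative degrees removes leading terms until filtration [- N], which is zero; the
    induction is on a bound [j] for [m + N]. *)
Lemma closed_neg k m x : m < 0 -> x \in Fil k m -> d x = 0 ->
  exists2 y, y \in Fil (k - 1) (m - 1) & x = d y.
Proof.
move=> m0; have : m <= `|m|%N%:Z - N%:Z + N%:Z by lia.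
rewrite -addrA; have [j] : exists j : nat, m <= j%:Z - N%:Z.
  by exists N; rewrite subrr ltW.
move=> hj _; elim: j m m0 hj x => [|j IHj] m m0 hj x xF dx.
  have : x \in Fil k (- N%:Z) by apply: FilW xF; lia.
  by rewrite FilN memv0 => /eqP ->; exists 0; rewrite ?mem0v ?linear0.
have [||y yF xyF] := gr_exact _ xF; rewrite ?dx ?mem0v //; first lia.
have [|||z zF xyz] := IHj (m - 1) _ _ _ xyF;
  rewrite ?linearB /= ?dx ?dd ?subrr //; try lia.
exists (y + z); last by rewrite linearD /= -xyz addrC subrK.
by rewrite memvD //; apply: FilW zF; lia.
Qed.

Definition cycles_top k := (Fil k N :&: lker d)%VS.
Definition bounds_top k := (d @: Fil (k - 1) N)%VS.

(** Both quotients equal [Z] modulo [B], the cohomology of [trunc], by the second isomorphism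
    theorem: [E1] and [E2] treat the whole complex, [E3] and [E4] the subquotient. *)
Lemma dim_gr0 k :
  (\dim (cycles_top k) + \dim (gr0_coboundaries k)
   = \dim (gr0_cocycles k) + \dim (bounds_top k))%N.
Proof.
pose Z := (trunc k :&: lker d)%VS; pose B := (d @: trunc (k - 1))%VS.
have top0 k' : (Fil k' 0 <= Fil k' N)%VS by apply: FilS.
have topn1 k' : (Fil k' (-1) <= Fil k' N)%VS by apply: FilS; lia.
have B1 : (B <= gr0_coboundaries k)%VS by apply: addvSl.
have ZP x : reflect (x \in Fil k 0 /\ d x = 0) (x \in Z).
  rewrite memv_cap memv_ker; apply: (iffP andP) => [[/truncP[xF _] /eqP dx]|[xF dx]] //.
  by split; [apply/truncP; rewrite dx mem0v | rewrite dx].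
have BZ : (B <= Z)%VS.
  apply/subvP => _ /memv_imgP[x /truncP[_ xF] ->]; apply/ZP.
  by rewrite dd; split=> //; move: xF; rewrite subrK.
have E1 : cycles_top k = (Z + bounds_top k)%VS.
  apply/eqP; rewrite eqEsubv; apply/andP; split.
    apply/subvP => x; rewrite memv_cap memv_ker => /andP[xF /eqP dx].
    have [y yF xy] := closed_lower xF dx.
    rewrite -(subrK (d y) x) memv_add ?memv_img //; apply/ZP; split=> //.
    by rewrite linearB /= dx dd subrr.
  rewrite subv_add; apply/andP; split.
    apply/subvP => x /ZP[xF dx]; rewrite memv_cap memv_ker dx eqxx andbT.
    exact: FilW xF.
  apply/subvP => _ /memv_imgP[y yF ->]; rewrite memv_cap memv_ker dd eqxx andbT.
  by move: (dFil' yF); apply/subvP/FilT.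
(* If [d y] lies in filtration 0, subtracting boundaries brings [y] down to filtration 0 without
   changing [d y]. *)
have E2 : (Z :&: bounds_top k <= B)%VS.
  apply/subvP => x; rewrite memv_cap => /andP[/ZP[xF _] /memv_imgP[y]].
  have : (N : int) <= N by []; move: {1 3}N => m.
  elim: m y => [|m IHm] y hm yF xE.
    apply/memv_imgP; exists y => //; apply/truncP; split=> //.
    by rewrite subrK -xE.
  have dyF : d y \in Fil (k - 1 + 1) m.+1.
    by rewrite subrK -xE; exact: FilW xF.
  have [//|z zF yz] := gr_exact _ yF dyF.
  apply: (IHm (y - d z)); first lia.
    by move: yz; rewrite -addn1 PoszD addrK.
  by rewrite linearB /= dd subr0.
have E3 : gr0_cocycles k = (Z + gr0_coboundaries k)%VS.
  apply/eqP; rewrite eqEsubv; apply/andP; split.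
    apply/subvP => x; rewrite memv_cap -memv_preim => /andP[xD].
    case/trunc_bdP=> u [v]; rewrite addrK => -[uF vF dxE].
    (* In [d x = u + d v] the term [u] is a cocycle of negative filtration, so [u = d w], and
       [x - (v + w)] is a cocycle. *)
    have du : d u = 0.
      have := congr1 d dxE; rewrite dd linearD /= dd addr0 => <- //.
    have [//|w wF uE] := closed_neg _ uF du.
    rewrite addrK in wF.
    have vwF : v + w \in Fil k (-1).
      by rewrite memvD //; apply: FilW wF; lia.
    rewrite -(subrK (v + w) x) memv_add //; last first.
      by apply/(subvP (addvSr _ _))/(subvP (addvSl _ _)).
    apply/ZP; split; last by rewrite linearB linearD /= dxE -uE [u + _]addrC subrr.
    case/truncP: xD => xF _; rewrite memvB //; exact: FilW vwF.
  rewrite subv_add; apply/andP; split.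
    apply/subvP => x /ZP[xF dx]; rewrite memv_cap -memv_preim dx mem0v andbT.
    by apply/truncP; rewrite dx mem0v.
  rewrite subv_add; apply/andP; split.
    apply: subv_trans BZ _; apply/subvP => x /ZP[xF dx].
    rewrite memv_cap -memv_preim dx mem0v andbT.
    by apply/truncP; rewrite dx mem0v.
  apply/subvP => x xI; rewrite memv_cap (subvP (trunc_bd_sub _) _ xI) /=.
  case/trunc_bdP: xI => u [v [uF vF ->]]; rewrite -memv_preim linearD /= dd addr0.
  by apply/trunc_bdP; exists 0, u; rewrite mem0v add0r addrK.
have E4 : (Z :&: gr0_coboundaries k <= B)%VS.
  apply/subvP => x; rewrite memv_cap => /andP[/ZP[xF dx]].
  case/memv_addP=> _ /memv_imgP[y yD ->] [_ /trunc_bdP[u [v [uF vF ->]]] xE].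
  have du : d u = 0 by move: dx; rewrite xE !linearD /= !dd add0r addr0.
  have [//|w wF uE] := closed_neg _ uF du.
  rewrite xE uE -!linearD memv_img // memvD // memvD //.
    apply: (subvP (trunc_bd_sub _)); apply/(subvP (addvSl _ _)).
    by apply: FilW wF; lia.
  by apply: (subvP (trunc_bd_sub _)); apply/(subvP (addvSl _ _)).
have E2' : (Z :&: bounds_top k)%VS = B.
  apply/eqP; rewrite eqEsubv E2 subv_cap BZ limgS //.
  exact: subv_trans (capvSl _ _) (top0 _).
have E4' : (Z :&: gr0_coboundaries k)%VS = B.
  by apply/eqP; rewrite eqEsubv E4 subv_cap BZ.
have := dimv_sum_cap Z (bounds_top k); have := dimv_sum_cap Z (gr0_coboundaries k).
rewrite E2' E4' -E1 -E3; lia.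
Qed.

End FilteredComplex.

Section FilteredDeformation.
Variables (F : fieldType) (V : vectType F) (d d' : 'End(V)).
Variables (Fil : int -> int -> {vspace V}) (N : nat).
Hypothesis dd : forall x, d (d x) = 0.
Hypothesis dd' : forall x, d' (d' x) = 0.
Hypothesis FilS : forall k m m' : int, m <= m' -> (Fil k m <= Fil k m')%VS.
Hypothesis FilT : forall k m, (Fil k m <= Fil k N)%VS.
Hypothesis FilN : forall k, Fil k (- N%:Z) = 0%VS.
Hypothesis dFil : forall (k m : int) x, x \in Fil k m -> d x \in Fil (k + 1) (m + 1).
(** The difference of [d'] and [d] lies two steps below the leading part of [d]. *)
Hypothesis deform : forall (k m : int) x, x \in Fil k m ->
  d' x - d x \in Fil (k + 1) (m - 1).
Hypothesis gr_exact : forall (k m : int) x, m != 0 -> x \in Fil k m ->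
  d x \in Fil (k + 1) m ->
  exists2 y, y \in Fil (k - 1) (m - 1) & x - d y \in Fil k (m - 1).

Let FilW (k m m' : int) x : m <= m' -> x \in Fil k m -> x \in Fil k m'.
Proof. by move/FilS/subvP; apply. Qed.

Let d'E (k m m' : int) x : m - 1 <= m' -> x \in Fil k m ->
  (d' x \in Fil (k + 1) m') = (d x \in Fil (k + 1) m').
Proof.
move=> mm' /deform /(FilW mm') dx; apply/idP/idP => h.
  by rewrite -(subKr (d' x) (d x)) memvB // opprK.
by rewrite -(subrK (d x) (d' x)) memvD.
Qed.

Lemma trunc_deform k : trunc d' Fil k = trunc d Fil k.
Proof.
apply/vspaceP => x; apply/truncP/truncP => -[xF dx]; split=> //;
by move: dx; rewrite (d'E _ xF).
Qed.

Let d'mem (k m : int) x (U : {vspace V}) : x \in Fil k m ->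
  (Fil (k + 1) (m - 1) <= U)%VS -> (d' x \in U) = (d x \in U).
Proof.
move=> /deform dx /subvP/(_ _ dx) dU; apply/idP/idP => h.
  by rewrite -(subKr (d' x) (d x)) memvB // opprK.
by rewrite -(subrK (d x) (d' x)) memvD.
Qed.

Lemma trunc_bd_deform k : trunc_bd d' Fil k = trunc_bd d Fil k.
Proof.
suff H (f g : 'End(V)) : (forall x, x \in Fil (k - 1) (-1) ->
    f x - g x \in Fil k (-1)) -> (trunc_bd f Fil k <= trunc_bd g Fil k)%VS.
  apply/eqP; rewrite eqEsubv !H // => x xF.
    by rewrite -opprB memvN; apply: FilW (_ : -1 - 1 <= -1) _ => //;
      move: (deform xF); rewrite subrK.
  by apply: FilW (_ : -1 - 1 <= -1) _ => //; move: (deform xF); rewrite subrK.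
move=> fg; apply/subvP => _ /trunc_bdP[u [v [uF vF ->]]].
apply/trunc_bdP; exists (u + (f v - g v)), v; split=> //; last by rewrite addrA subrK.
by rewrite memvD ?fg.
Qed.

Lemma gr0_cocycles_deform k : gr0_cocycles d' Fil k = gr0_cocycles d Fil k.
Proof.
rewrite /gr0_cocycles trunc_deform trunc_bd_deform; apply/vspaceP => x.
rewrite [LHS]memv_cap [RHS]memv_cap -!memv_preim.
have [/truncP[xF _]|//] := boolP (x \in trunc d Fil k).
by rewrite (d'mem xF) // sub0r addvSl.
Qed.

Lemma gr0_coboundaries_deform k :
  gr0_coboundaries d' Fil k = gr0_coboundaries d Fil k.
Proof.
rewrite /gr0_coboundaries trunc_deform trunc_bd_deform.
suff H (f g : 'End(V)) :
    (forall x, x \in trunc d Fil (k - 1) -> f x - g x \in Fil k (-1)) ->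
    (f @: trunc d Fil (k - 1) + trunc_bd d Fil k <=
     g @: trunc d Fil (k - 1) + trunc_bd d Fil k)%VS.
  apply/eqP; rewrite eqEsubv !H // => x /truncP[xF _].
    by rewrite -opprB memvN; move: (deform xF); rewrite subrK sub0r.
  by move: (deform xF); rewrite subrK sub0r.
move=> fg; rewrite subv_add addvSr andbT; apply/subvP => _ /memv_imgP[x xD ->].
rewrite -(subrK (g x) (f x)) addrC memv_add ?memv_img //.
exact: subvP (addvSl _ _) _ (fg x xD).
Qed.

(** [d'] inherits the hypotheses on [d], and both induce the same differential on [trunc] modulo
    [trunc_bd]; [dim_gr0] is applied to each. *)
Lemma dim_deform k :
  (\dim (cycles_top d Fil N k) + \dim (bounds_top d' Fil N k)
   = \dim (cycles_top d' Fil N k) + \dim (bounds_top d Fil N k))%N.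
Proof.
have dFil' (j m : int) x : x \in Fil j m -> d' x \in Fil (j + 1) (m + 1).
  by move=> xF; rewrite (d'E _ xF) ?dFil //; lia.
have gr_exact' (j m : int) x : m != 0 -> x \in Fil j m ->
    d' x \in Fil (j + 1) m ->
    exists2 y, y \in Fil (j - 1) (m - 1) & x - d' y \in Fil j (m - 1).
  move=> m0 xF; rewrite (d'E _ xF) ?gerBl // => /(gr_exact m0 xF)[y yF xy].
  exists y => //; have -> : x - d' y = (x - d y) - (d' y - d y).
    by rewrite opprB addrA subrK.
  rewrite memvB //.
  by apply: FilW (_ : m - 1 - 1 <= _) _; first lia; move: (deform yF); rewrite subrK.
have := dim_gr0 dd FilS FilT FilN dFil gr_exact k.
have := dim_gr0 dd' FilS FilT FilN dFil' gr_exact' k.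
rewrite gr0_cocycles_deform gr0_coboundaries_deform; lia.
Qed.

End FilteredDeformation.

(** * Representations of sl_2 and reflections *)

Section Sl2Strings.
Variables (K : fieldType) (V : vectType K) (E F H : 'End(V)) (W : {vspace V}).
Hypothesis EW : forall x, x \in W -> E x \in W.
Hypothesis FW : forall x, x \in W -> F x \in W.
(** The relations are restricted to a stable subspace because they will be applied on the kernel of
    a contraction. *)
Hypothesis EF : forall x, x \in W -> E (F x) = F (E x) + H x.
Hypothesis HE : forall x, x \in W -> H (E x) = E (H x) + 2%:R *: E x.

Lemma iterEW k x : x \in W -> iter k E x \in W.
Proof. by move=> xW; elim: k => //= k IHk; apply: EW. Qed.

Lemma iterFW k x : x \in W -> iter k F x \in W.
Proof. by move=> xW; elim: k => //= k IHk; apply: FW. Qed.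

Lemma iterE_weight c k x : x \in W -> H x = c *: x ->
  H (iter k E x) = (c + (2 * k)%:R) *: iter k E x.
Proof.
move=> xW Hx; elim: k => [|k IHk] /=; first by rewrite muln0 addr0.
rewrite HE ?iterEW // IHk linearZ /= -scalerDl mulnS natrD.
by congr (_ *: _); ring.
Qed.

Lemma iterE_F c k x : x \in W -> H x = c *: x ->
  iter k.+1 E (F x) =
    F (iter k.+1 E x) + (k.+1%:R * (c + k%:R)) *: iter k E x.
Proof.
move=> xW Hx; elim: k => [|k IHk]; first by rewrite /= EF // Hx addr0 mul1r.
rewrite [LHS]iterS IHk linearD linearZ /= -/(iter k.+1 E x) EF ?iterEW //.
rewrite (iterE_weight _ xW Hx) -addrA -scalerDl; congr (_ + _ *: _).
by rewrite mulnS natrD; ring.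
Qed.

(** The scalar is the square of k factorial. *)
Lemma iterFE_lowest (k : nat) x : x \in W -> F x = 0 -> H x = - k%:R *: x ->
  (forall j, (0 < j <= k)%N -> j%:R != 0 :> K) ->
  exists2 c, c != 0 & iter k F (iter k E x) = c *: x.
Proof.
move=> xW Fx Hx k0.
suff /(_ k (leqnn k)): forall j, (j <= k)%N ->
  exists2 c, c != 0 & iter j F (iter j E x) = c *: x by [].
elim=> [|j IHj] jk; first by exists 1; rewrite ?oner_eq0 ?scale1r.
case: (IHj (ltnW jk)) => c c0 IH.
exists (j.+1%:R * (k - j)%:R * c); first by rewrite !mulf_neq0 ?k0 //; lia.
have := iterE_F j xW Hx; rewrite Fx.
have -> : iter j.+1 E 0 = 0 by elim: j.+1 => //= i ->; rewrite linear0.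
move/eqP; rewrite eq_sym addr_eq0 => /eqP e.
rewrite iterSr e -scaleNr -scalerA -IH.
have lF a i y : iter i F (a *: y) = a *: iter i F y.
  by elim: i => //= i ->; rewrite linearZ.
rewrite lF; congr (_ *: _).
by rewrite natrB ?(ltnW jk) //; ring.
Qed.

(** Induction on [r]: [F x] has weight -(k + 2) and is killed by the power k + 2 of [E], so it
    vanishes, and [iterFE_lowest] applies to [x]. Each descent lowers the weight by 2, whence the
    bound k + 2r. *)
Lemma iterE_inj r (k : nat) x : x \in W -> H x = - k%:R *: x ->
  (forall y, y \in W -> H (F y) = F (H y) - 2%:R *: F y) ->
  (forall j, (0 < j < k + 2 * r)%N -> j%:R != 0 :> K) ->
  iter r F x = 0 -> iter k E x = 0 -> x = 0.
Proof.
move=> xW Hx HF; elim: r k x xW Hx => [//|r IHr] k x xW Hx k0 Fr Ek.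
have Fx0 : F x = 0.
  apply: (IHr k.+2) => //.
  - exact: FW.
  - by rewrite HF // Hx linearZ /= -scalerBl -addn2 natrD; congr (_ *: _); ring.
  - by move=> j hj; apply: k0; lia.
  - by rewrite -iterSr.
  by rewrite (iterE_F _ xW Hx) !iterS Ek !linear0 ?scaler0 addr0.
case: (iterFE_lowest xW Fx0 Hx) => [j hj|c c0]; first by apply: k0; lia.
have -> : iter k F (iter k E x) = 0.
  by rewrite Ek; elim: (k) => //= i ->; rewrite linear0.
by move/eqP; rewrite eq_sym scaler_eq0 (negPf c0) => /eqP.
Qed.

End Sl2Strings.

Lemma iter_lfun (K : fieldType) (V : vectType K) (E : 'End(V)) k :
  exists g : 'End(V), forall x, g x = iter k E x.
Proof.
elim: k => [|k [g gE]]; first by exists \1%VF => x; rewrite lfunE.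
by exists (E \o g)%VF => x; rewrite comp_lfunE gE.
Qed.

Section Sl2Surjective.
Variables (K : fieldType) (V : vectType K) (E F H : 'End(V)) (W : {vspace V}).
Variables (N k : nat).
Hypothesis EW : forall x, x \in W -> E x \in W.
Hypothesis FW : forall x, x \in W -> F x \in W.
Hypothesis EF : forall x, x \in W -> E (F x) = F (E x) + H x.
Hypothesis HE : forall x, x \in W -> H (E x) = E (H x) + 2%:R *: E x.
Hypothesis HF : forall x, x \in W -> H (F x) = F (H x) - 2%:R *: F x.
Hypothesis EN : forall x, iter N E x = 0.
Hypothesis FN : forall x, iter N F x = 0.
Hypothesis nz : forall j, (0 < j < k + 2 * N)%N -> j%:R != 0 :> K.

Let W_ (c : K) : {vspace V} := (W :&: lker (H - c *: \1%VF))%VS.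

Let W_P c x : reflect (x \in W /\ H x = c *: x) (x \in W_ c).
Proof.
rewrite memv_cap memv_ker !lfun_simp subr_eq0.
by apply: (iffP andP) => [[xW /eqP]|[xW ->]].
Qed.

Lemma iterE_lower_inj x : x \in W -> H x = - k%:R *: x -> iter k E x = 0 ->
  x = 0.
Proof. by move=> xW Hx; apply: (iterE_inj EW FW EF HE xW Hx HF nz (FN x)). Qed.

Lemma iterF_upper_inj x : x \in W -> H x = k%:R *: x -> iter k F x = 0 ->
  x = 0.
Proof.
move=> xW Hx.
(* The symmetry of sl_2 exchanges [E] and [F] and negates [H]. *)
apply: (@iterE_inj K V F E (- H) W FW EW _ _ N k x xW) => // [y yW|y yW||y yW].
- by rewrite EF // !lfun_simp addrK.
- by rewrite !lfun_simp HF // opprB linearN addrC.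
- by rewrite !lfun_simp Hx scaleNr.
- by rewrite !lfun_simp HE // linearN opprD.
Qed.

(** The k-th powers of [E] and [F] are injective between the weight spaces for -k and k, so these
    have equal dimension. *)
Lemma iterE_surj x : x \in W -> H x = k%:R *: x ->
  exists y, [/\ y \in W, H y = - k%:R *: y & iter k E y = x].
Proof.
move=> xW Hx; have [g gE] := iter_lfun E k; have [h hE] := iter_lfun F k.
have gU : (g @: W_ (- k%:R) <= W_ k%:R)%VS.
  apply/subvP => _ /memv_imgP[y /W_P[yW Hy] ->]; apply/W_P.
  rewrite gE iterEW // (iterE_weight EW HE _ yW Hy); split=> //.
  by congr (_ *: _); rewrite natrM; ring.
have hU : (h @: W_ k%:R <= W_ (- k%:R))%VS.
  apply/subvP => _ /memv_imgP[y /W_P[yW Hy] ->]; apply/W_P.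
  rewrite hE (iterFW FW) //; split=> //.
  have HF' z : z \in W -> (- H)%VF (F z) = F ((- H)%VF z) + 2%:R *: F z.
    by move=> zW; rewrite !lfun_simp HF // opprB linearN addrC.
  have Hy' : (- H)%VF y = - k%:R *: y by rewrite !lfun_simp Hy scaleNr.
  have := iterE_weight FW HF' k yW Hy'; rewrite !lfun_simp => /(canRL opprK) ->.
  by rewrite -scaleNr; congr (_ *: _); rewrite natrM; ring.
have dg : \dim (g @: W_ (- k%:R)) = \dim (W_ (- k%:R)).
  apply: limg_dim_eq; apply/eqP; rewrite -subv0; apply/subvP => y.
  rewrite memv_cap memv_ker gE memv0 => /andP[/W_P[yW Hy] /eqP].
  by move/(iterE_lower_inj yW Hy)/eqP.
have dh : \dim (h @: W_ k%:R) = \dim (W_ k%:R).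
  apply: limg_dim_eq; apply/eqP; rewrite -subv0; apply/subvP => y.
  rewrite memv_cap memv_ker hE memv0 => /andP[/W_P[yW Hy] /eqP].
  by move/(iterF_upper_inj yW Hy)/eqP.
have eg : (g @: W_ (- k%:R))%VS = W_ k%:R.
  by apply/eqP; rewrite eqEdim gU dg -dh dimvS.
have : x \in W_ k%:R by apply/W_P.
by rewrite -eg => /memv_imgP[y /W_P[yW Hy] ->]; exists y; rewrite -gE.
Qed.

End Sl2Surjective.

(** * Transport of exactness across a simple reflection *)

Section Reflection.
Variables (K : fieldType) (V : vectType K) (alpha X iota f H : 'End(V)).
Variables (N k : nat).
Hypothesis iotaX : forall x, iota (X x) = x - X (iota x).
Hypothesis XX : forall x, X (X x) = 0.
Hypothesis iota2 : forall x, iota (iota x) = 0.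
Hypothesis alpha2 : forall x, alpha (alpha x) = 0.
Hypothesis alphaX : forall x, alpha (X x) = - X (alpha x).
Hypothesis fiota : forall x, f (iota x) = iota (f x).
Hypothesis alphaf : forall x, alpha (f x) = f (alpha x) + X (H x).
Hypothesis Halpha : forall x, H (alpha x) = alpha (H x).
Hypothesis HX : forall x, H (X x) = X (H x) - 2%:R *: X x.
Hypothesis Hiota : forall x, H (iota x) = iota (H x) + 2%:R *: iota x.
Hypothesis Hf : forall x, H (f x) = f (H x) - 2%:R *: f x.

(** Cartan's formula for a Lie derivative: [alpha] plays the differential, [X] multiplication by a
    generator and [iota] contraction by it. With [f] and [H] it gives sl_2 relations on the kernel
    of [iota]. *)
Definition raising : 'End(V) := ((alpha \o iota) + (iota \o alpha))%VF.

Hypothesis raisingN : forall x, iter N raising x = 0.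
Hypothesis fN : forall x, iter N f x = 0.
Hypothesis nz : forall j, (0 < j < k + 2 * N)%N -> j%:R != 0 :> K.
Hypothesis k_gt0 : (0 < k)%N.

Let e := raising.

Lemma raisingE x : e x = alpha (iota x) + iota (alpha x).
Proof. by rewrite !lfun_simp. Qed.

Let e_iota x : e (iota x) = iota (e x).
Proof. by rewrite !raisingE iota2 linear0 add0r linearD /= iota2 addr0. Qed.

Let e_alpha x : e (alpha x) = alpha (e x).
Proof. by rewrite !raisingE alpha2 linear0 addr0 linearD /= alpha2 add0r. Qed.

Let e_X x : e (X x) = X (e x).
Proof.
rewrite !raisingE iotaX alphaX (linearB alpha) (linearN iota) /= iotaX alphaX.
by rewrite (linearD X) opprK opprB addrC addrA subrK addrC.
Qed.

Let eH x : H (e x) = e (H x) + 2%:R *: e x.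
Proof.
rewrite !raisingE linearD /= Halpha !Hiota linearD linearZ /= Halpha scalerDr.
by rewrite addrACA.
Qed.

Let ef x : iota x = 0 -> e (f x) = f (e x) + H x.
Proof.
move=> ix; have iH : iota (H x) = 0.
  by move: (Hiota x); rewrite ix !linear0 addr0.
rewrite !raisingE -fiota ix !linear0 !add0r alphaf linearD /= -fiota.
by rewrite iotaX iH linear0 subr0.
Qed.

Let W := lker iota.

Let WP x : reflect (iota x = 0) (x \in W).
Proof. by rewrite memv_ker; apply: eqP. Qed.

Let eW x : x \in W -> e x \in W.
Proof. by move=> /WP ix; apply/WP; rewrite -e_iota ix linear0. Qed.

Let fW x : x \in W -> f x \in W.
Proof. by move=> /WP ix; apply/WP; rewrite -fiota ix linear0. Qed.

Let efW x : x \in W -> e (f x) = f (e x) + H x.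
Proof. by move/WP/ef. Qed.

Let surj := iterE_surj eW fW efW (fun x _ => eH x) (fun x _ => Hf x)
  raisingN fN nz.

Let inj := iterE_lower_inj eW fW efW (fun x _ => eH x) (fun x _ => Hf x)
  fN nz.

(** [iota z] has weight k, so it is the k-th power of [e] applied to some [y] in the kernel of
    [iota]. There [e] is [alpha] followed by [iota], so applying [e] only k - 1 times gives the
    correction. *)
Lemma reflection_reduce z : alpha z = 0 -> H z = (k%:R - 2%:R) *: z ->
  exists y, iota (z - alpha y) = 0.
Proof.
move=> az Hz; have iW : iota z \in W by apply/WP.
have Hi : H (iota z) = k%:R *: iota z.
  by rewrite Hiota Hz linearZ -scalerDl subrK.
have [y [/WP iy Hy ye]] := surj iW Hi.
exists (iter k.-1 e y); rewrite linearB /=.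
have iw : iota (iter k.-1 e y) = 0 by apply/WP/iterEW => //; apply/WP.
have := raisingE (iter k.-1 e y); rewrite iw linear0 add0r => <-.
by rewrite -iterS prednK // ye subrr.
Qed.

(* The part of [alpha] that does not involve the generator [X]. *)
Let delta x := alpha x - X (e x).

Let delta_iota x : iota (delta x) = - delta (iota x).
Proof.
rewrite /delta (linearB iota) /= iotaX e_iota; move: (X (iota (e x))) => w.
rewrite raisingE !opprB opprD addrCA; congr (w + _).
by rewrite addrCA subrr addr0.
Qed.

Let e_delta x : e (delta x) = delta (e x).
Proof. by rewrite /delta linearB /= e_alpha e_X. Qed.

Let delta_H x : H (delta x) = delta (H x).
Proof.
have XD a u v : X (u + a *: v) = X u + a *: X v by rewrite addrC linearP addrC.
by rewrite /delta linearB /= Halpha HX eH XD addrK.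
Qed.

Let delta_linear : linear delta.
Proof.
move=> a x y; rewrite /delta !(linearP alpha, linearP e, linearP X).
by rewrite scalerBr opprD addrACA.
Qed.

(** Here [z] is a highest weight vector of weight k - 2, zero if k = 1. For k > 1, a primitive of
    its reflection, of weight -k, is moved up along [e] to a primitive of [z]. *)
Lemma reflection_exact z : iota z = 0 -> alpha z = 0 ->
  H z = (k%:R - 2%:R) *: z ->
  ((1 < k)%N -> exists2 y, alpha y = X (iter (k - 2) f z) & H y = - k%:R *: y) ->
  exists y, alpha y = z.
Proof.
move=> iz az Hz; have zW : z \in W by apply/WP.
have ez : e z = 0 by rewrite raisingE iz az !linear0 addr0.
have [k1|k_neq1] := eqVneq k 1%N.
  move=> _; exists 0; rewrite linear0; apply/esym/inj => //.
    by rewrite Hz k1; congr (_ *: _); ring.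
  by rewrite k1.
have k1 : (1 < k)%N by lia.
move=> /(_ k1)[y ay Hy].
(* With [e] and [f] exchanged, [z] is a lowest weight vector; hence raising its (k - 2)-fold
   lowering back gives [c *: z]. *)
have fe w : w \in W -> f (e w) = e (f w) + (- H)%VF w.
  by move=> wW; rewrite !opp_lfunE efW // addrK.
have H'f w : w \in W -> (- H)%VF (f w) = f ((- H)%VF w) + 2%:R *: f w.
  by move=> wW; rewrite !opp_lfunE Hf opprB linearN addrC.
have H'z : (- H)%VF z = - (k - 2)%:R *: z.
  by rewrite !opp_lfunE Hz natrB // scaleNr.
have [j hj|c c0 ce] := iterFE_lowest fW fe H'f zW ez H'z; first by apply: nz; lia.
(* Split [y] into [y0 + X y1] with [y0] and [y1] free of the generator; comparing the two parts of
   [alpha y] yields [E1] and [E2]. *)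
set y1 := iota y; set y0 := y - X y1.
have iy0 : iota y0 = 0 by rewrite /y0 linearB /= iotaX /y1 iota2 linear0 subr0 subrr.
have yE : y = y0 + X y1 by rewrite subrK.
have y0W : y0 \in W by apply/WP.
have Hy1 : H y1 = (2%:R - k%:R) *: y1.
  by rewrite Hiota Hy linearZ -scalerDl addrC.
have Hy0 : H y0 = - k%:R *: y0.
  rewrite linearB /= HX Hy1 Hy scalerBr linearZ /= -scalerBl; congr (_ - _ *: _).
  by ring.
clearbody y0.
have fzW : iter (k - 2) f z \in W by apply: iterFW.
have iX w : w \in W -> iota (X w) = w.
  by move=> /WP iw; rewrite iotaX iw linear0 subr0.
have delta0 : delta 0 = 0 by rewrite /delta (linear0 alpha) (linear0 e) (linear0 X) subr0.
have dW w : w \in W -> delta w \in W.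
  by move=> /WP iw; apply/WP; rewrite delta_iota iw delta0 oppr0.
have y1W : y1 \in W by apply/WP; rewrite iota2.
have E0 : delta y0 + X (e y0 - delta y1) = X (iter (k - 2) f z).
  rewrite -ay yE (linearD alpha) /= alphaX /delta !(linearB X) /= XX subr0 addrA.
  by rewrite subrK.
have iter_delta j u : iter j e (delta u) = delta (iter j e u).
  by elim: j => //= j ->.
have iterB j u v : iter j e (u - v) = iter j e u - iter j e v.
  by elim: j => //= j ->; rewrite linearB.
have deltaB u v : delta (u - v) = delta u - delta v.
  by have := delta_linear (-1) v u; rewrite !scaleN1r ![- _ + _]addrC.
have wW : e y0 - delta y1 \in W by rewrite memvB ?eW ?dW.
have dy0W : delta y0 \in W by apply: dW.
have E1 : e y0 - delta y1 = iter (k - 2) f z.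
  by have := congr1 iota E0; rewrite linearD /= !iX // (WP _ dy0W) add0r.
have E2 : delta y0 = 0 by move: E0; rewrite E1 => /(canRL (addrK _)); rewrite subrr.
have E3 : iter k.-1 e y0 - delta (iter (k - 2) e y1) = c *: z.
  rewrite -ce -E1 iterB iter_delta -iterSr; congr (iter _ e y0 - _); lia.
have Hey1 : H (iter k.-1 e y1) = k%:R *: iter k.-1 e y1.
  rewrite (iterE_weight eW (fun x _ => eH x) _ y1W Hy1); congr (_ *: _).
  by rewrite natrM -subn1 natrB //; ring.
(* [y2] serves to make [e psi] vanish below; injectivity on weight -k then forces
   [y0 = delta y2]. *)
have [y2 [y2W Hy2 y2E]] := surj (iterEW eW _ y1W) Hey1.
have iterSe j u : e (iter j e u) = iter j.+1 e u by [].
have E4 : iter k e (y0 - delta y2) = 0.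
  have := congr1 e E3; rewrite linearB /= e_delta linearZ /= ez scaler0 !iterSe.
  rewrite prednK // (_ : (k - 2).+1 = k.-1); last lia.
  by rewrite iterB iter_delta y2E.
have E5 : y0 = delta y2.
  apply/eqP; rewrite -subr_eq0; apply/eqP; apply: inj => //.
    by rewrite memvB ?dW.
  rewrite linearB /= delta_H Hy0 Hy2 scalerBr; congr (_ - _).
  by have := delta_linear (- k%:R) y2 0; rewrite delta0 !addr0.
(* As [e psi = 0], [alpha psi] is [delta psi], which is [c *: z] by [E5] and [E3]. *)
pose psi := iter k.-1 e y2 - iter (k - 2) e y1.
have epsi : e psi = 0.
  rewrite /psi linearB /= !iterSe prednK // y2E.
  by rewrite (_ : (k - 2).+1 = k.-1) ?subrr //; lia.
exists (c^-1 *: psi); rewrite linearZ /= -(subrK (X (e psi)) (alpha psi)).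
rewrite -/(delta psi) epsi linear0 addr0 deltaB -iter_delta -E5 E3.
by rewrite scalerA mulVf // scale1r.
Qed.

End Reflection.

(** * Gradings of exterior algebras *)

Section ExteriorGradings.
Variables (F : fieldType) (I : finType).
Local Notation Lambda := (ext F I).
Implicit Types (S T U : {set I}) (P Q R : pred {set I}) (D : 'End(Lambda)).

Lemma ext_spanS P Q x : (forall S, P S -> Q S) ->
  x \in ext_span F P -> x \in ext_span F Q.
Proof.
move=> PQ /ext_spanP xP; apply/ext_spanP => S QS; apply: xP.
by apply: contra QS; apply: PQ.
Qed.

Lemma ext_span_lfun P D (W : {vspace Lambda}) x :
  (forall S, P S -> D (ext_mono F S) \in W) -> x \in ext_span F P -> D x \in W.
Proof.
move=> DW; move: x; apply: ext_span_ind => [|a x y Dx Dy|S /DW //].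
  by rewrite linear0 mem0v.
by rewrite linearP memvD ?memvZ.
Qed.

Lemma ext_lfun_ind D D' : D 1 = D' 1 ->
  (forall t x, D x = D' x -> D (ext_gen F t * x) = D' (ext_gen F t * x)) ->
  forall x, D x = D' x.
Proof.
move=> D1 DM x; rewrite (ext_sum x) !linear_sum; apply: eq_bigr => S _ /=.
rewrite !linearZ /=; congr (_ *: _); rewrite ext_monoE.
elim: (enum S) => [|t w IHw]; first by rewrite big_nil.
by rewrite big_cons DM.
Qed.

Definition ext_proj P (x : Lambda) : Lambda := [ffun S => if P S then x S else 0].

Fact ext_proj_linear P : linear (ext_proj P).
Proof.
move=> a x y; apply/ffunP => S; rewrite !ffunE.
by case: ifP => _ //; rewrite scaler0 addr0.
Qed.

HB.instance Definition _ P := GRing.isLinear.Build F Lambda Lambda *:%R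
  (ext_proj P) (ext_proj_linear P).

Lemma ext_proj_span P x : ext_proj P x \in ext_span F P.
Proof. by apply/ext_spanP => S /negPf PS; rewrite ffunE PS. Qed.

Lemma ext_proj_id P x : x \in ext_span F P -> ext_proj P x = x.
Proof.
move/ext_spanP=> xP; apply/ffunP => S; rewrite ffunE.
by case: ifP => // /negbT/xP.
Qed.

Lemma ext_proj_eq0 P Q x : (forall S, P S -> ~~ Q S) -> x \in ext_span F Q ->
  ext_proj P x = 0.
Proof.
move=> PQ /ext_spanP xQ; apply/ffunP => S; rewrite !ffunE.
by case: ifP => // /PQ/xQ.
Qed.

Section Graded.
Variables (M : zmodType) (g : I -> M).

Definition wsum S : M := \sum_(s in S) g s.

Definition hspan c : {vspace Lambda} := ext_span F (fun S => wsum S == c).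

Definition homogeneous D k :=
  forall S, D (ext_mono F S) \in hspan (wsum S + k).

Lemma wsumU S T : [disjoint S & T] -> wsum (S :|: T) = wsum S + wsum T.
Proof.
by move=> dST; rewrite /wsum -bigU //; apply: eq_bigl => s; rewrite !inE.
Qed.

Lemma wsum1 s : wsum [set s] = g s. Proof. exact: big_set1. Qed.

Lemma hspan_eq0 c x : (forall S, wsum S != c) -> x \in hspan c -> x = 0.
Proof.
by move=> cS /ext_spanP x0; apply/ffunP => S; rewrite x0 ?cS // ffunE.
Qed.

Lemma homogeneous_span D k c x : homogeneous D k ->
  x \in hspan c -> D x \in hspan (c + k).
Proof. by move=> Dk; apply: ext_span_lfun => S /eqP <-. Qed.

Lemma homogeneous_iter D k c j x : homogeneous D k ->
  x \in hspan c -> iter j D x \in hspan (c + k *+ j).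
Proof.
move=> Dk xc; elim: j => [|j IHj]; first by rewrite mulr0n addr0.
by rewrite mulrSr addrA /=; apply: homogeneous_span.
Qed.

Lemma homogeneous_proj D k c x : homogeneous D k ->
  D (ext_proj (fun S => wsum S == c) x)
  = ext_proj (fun S => wsum S == c + k) (D x).
Proof.
move=> Dk; rewrite (ext_sum x) !linear_sum /=; apply: eq_bigr => S _.
rewrite !linearZ /=; congr (_ *: _).
have [Sc|Sc] := eqVneq (wsum S) c.
  rewrite !ext_proj_id ?ext_mono_span ?Sc //; first by rewrite -Sc; apply: Dk.
rewrite (ext_proj_eq0 (Q := pred1 S)) ?ext_mono_span ?linear0 //=; last first.
  by move=> U /eqP UE; apply/eqP => US; rewrite -UE US eqxx in Sc.
apply/esym/(ext_proj_eq0 _ (Dk S)) => U /eqP ->.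
by rewrite (inj_eq (addIr _)) eq_sym.
Qed.

Lemma homogeneous_comp D D' k k' : homogeneous D k -> homogeneous D' k' ->
  homogeneous (D \o D')%VF (k' + k).
Proof.
by move=> Dk Dk' S; rewrite comp_lfunE addrA; apply: homogeneous_span.
Qed.

Lemma homogeneousD D D' k : homogeneous D k -> homogeneous D' k ->
  homogeneous (D + D')%VF k.
Proof. by move=> Dk Dk' S; rewrite add_lfunE memvD. Qed.

Lemma ext_gen_hspan t : ext_gen F t \in hspan (g t).
Proof. by apply: ext_gen_span; rewrite wsum1. Qed.

Lemma hspanM a b x y : x \in hspan a -> y \in hspan b -> x * y \in hspan (a + b).
Proof. by apply: ext_spanM => S T /eqP <- /eqP <- /wsumU ->. Qed.

End Graded.

Lemma wsum_morph (M M' : zmodType) (g : I -> M) (f : M -> M') S :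
  {morph f : x y / x + y} -> wsum (fun t => f (g t)) S = f (wsum g S).
Proof.
move=> fD; have f0 : f 0 = 0 by apply: (addrI (f 0)); rewrite -fD !addr0.
by rewrite /wsum (big_morph f fD f0).
Qed.

Lemma homogeneous_morph (M M' : zmodType) (g : I -> M) (f : M -> M') D k :
  {morph f : x y / x + y} -> homogeneous g D k ->
  homogeneous (fun t => f (g t)) D (f k).
Proof.
move=> fD Dk S; apply: ext_spanS (Dk S) => T /eqP.
by rewrite !wsum_morph // => ->; rewrite fD.
Qed.

Lemma ext_deriv_span (G : I -> Lambda) (P : I -> pred {set I}) Q R x :
  (forall s, G s \in ext_span F (P s)) ->
  (forall s S U, s \notin S -> Q (s |: S) -> P s U -> [disjoint U & S] ->
    R (U :|: S)) ->
  x \in ext_span F Q -> ext_deriv G x \in ext_span F R.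
Proof.
move=> GP PQR xQ; rewrite lfunE /=; apply: memv_suml => s _.
have xs : ext_contr s x \in ext_span F (fun S => (s \notin S) && Q (s |: S)).
  by apply: ext_span_contr xQ => S -> ->.
by apply: ext_spanM (GP s) xs => U S PU /andP[sS QS]; apply: PQR PU.
Qed.

Lemma homogeneous_deriv (M : zmodType) (g : I -> M) (G : I -> Lambda) k :
  (forall s, G s \in hspan g (g s + k)) -> homogeneous g (ext_deriv G) k.
Proof.
move=> Gk S; apply: (ext_deriv_span (Q := pred1 S) Gk) => [s T U sT /eqP <-|]; last first.
  by apply: ext_mono_span => /=.
move=> /eqP Us UT; rewrite wsumU // Us /wsum big_setU1 //=.
by rewrite addrAC.
Qed.

Lemma ext_deriv_genM_even (G : I -> Lambda) t x :
  (forall s, G s \in ext_homog F I 1) ->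
  ext_deriv G (ext_gen F t * x) = G t * x + ext_gen F t * ext_deriv G x.
Proof.
move=> G1; rewrite !lfunE /= /ext_deriv_fun mulr_sumr.
under eq_bigr => s _ do rewrite ext_contr_gen mulrBr mulrA.
rewrite big_split /=; congr (_ + _).
  rewrite (bigD1 t) //= eqxx scale1r big1 ?addr0 // => s /negPf ->.
  by rewrite scale0r mulr0.
apply: eq_bigr => s _.
by rewrite mulrA (ext_gen_comm _ (G1 s)) expr1 scaleN1r mulNr.
Qed.

Definition gen_mul_fun t (x : Lambda) : Lambda := ext_gen F t * x.

Fact gen_mul_linear t : linear (gen_mul_fun t).
Proof. by move=> a x y; rewrite /gen_mul_fun mulrDr scalerAr. Qed.

HB.instance Definition _ t := GRing.isLinear.Build F Lambda Lambda *:%R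
  (gen_mul_fun t) (gen_mul_linear t).

Definition gen_mul t : 'End(Lambda) := linfun (gen_mul_fun t).
Definition gen_contr t : 'End(Lambda) := linfun (ext_contr t).

Lemma gen_mulE t x : gen_mul t x = ext_gen F t * x.
Proof. by rewrite lfunE. Qed.

Lemma gen_contrE t x : gen_contr t x = ext_contr t x.
Proof. by rewrite lfunE. Qed.

Lemma homogeneous_mul (M : zmodType) (g : I -> M) t :
  homogeneous g (gen_mul t) (g t).
Proof.
move=> S; rewrite gen_mulE addrC; apply: hspanM; first exact: ext_gen_hspan.
exact: ext_mono_span.
Qed.

Lemma homogeneous_contr (M : zmodType) (g : I -> M) t :
  homogeneous g (gen_contr t) (- g t).
Proof.
move=> S; rewrite gen_contrE; apply: (ext_span_contr (P := pred1 S)).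
  by move=> T tT /eqP <-; rewrite /wsum big_setU1 //= [g t + _]addrC addrK.
by apply: ext_mono_span => /=.
Qed.

Lemma gen_mul_contr t (x : Lambda) S :
  (ext_gen F t * ext_contr t x) S = if t \in S then x S else 0.
Proof.
rewrite ext_gen_mulE; case: ifP => // tS; rewrite ffunE !inE eqxx /=.
by rewrite setD1K // mulrA ext_sign_sq mul1r.
Qed.

Definition ext_weight_fun (g : I -> int) (x : Lambda) : Lambda :=
  [ffun S => (wsum g S)%:~R *: x S].

Fact ext_weight_linear g : linear (ext_weight_fun g).
Proof.
by move=> a x y; apply/ffunP => S; rewrite !ffunE scalerDr !scalerA mulrC.
Qed.

HB.instance Definition _ g := GRing.isLinear.Build F Lambda Lambda *:%R
  (ext_weight_fun g) (ext_weight_linear g).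

Definition ext_weight g : 'End(Lambda) := linfun (ext_weight_fun g).

Lemma ext_weightE g c x : x \in hspan g c -> ext_weight g x = c%:~R *: x.
Proof.
move/ext_spanP=> xc; apply/ffunP => S; rewrite lfunE !ffunE.
by have [->//|/xc ->] := eqVneq (wsum g S) c; rewrite !scaler0.
Qed.

Lemma ext_weight_homogeneous g D k x : homogeneous g D k ->
  ext_weight g (D x) = D (ext_weight g x) + k%:~R *: D x.
Proof.
move=> Dk; rewrite (ext_sum x) !linear_sum /= ?scaler_sumr -big_split /=.
apply: eq_bigr => S _; rewrite !linearZ /=.
rewrite (ext_weightE (Dk S)) [ext_weight g (ext_mono F S)](@ext_weightE g (wsum g S)).
  by rewrite !linearZ /= !scalerA -scalerDl mulrzDr; congr (_ *: _); ring.
exact: ext_mono_span.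
Qed.

(** N applications would lower the weight by more than the spread of all weights. *)
Lemma homogeneous_nilpotent (g : I -> int) D N x : homogeneous g D (-1) ->
  (forall S T, wsum g S - wsum g T < N%:Z) -> iter N D x = 0.
Proof.
move=> Dk bound; have [h hE] := iter_lfun D N.
rewrite -hE; have -> : h = 0; last by rewrite lfunE.
apply/lfunP => y; rewrite lfunE /= (ext_sum y) linear_sum big1 // => S _ /=.
rewrite linearZ /= hE; apply/eqP; rewrite scaler_eq0; apply/orP; right; apply/eqP.
apply: (hspan_eq0 (c := wsum g S + -1 *+ N) (g := g)).
  move=> T; apply/eqP => TS; have := bound S T; rewrite TS.
  by rewrite mulNrn opprB addrC subrK natz ltxx.
by apply: homogeneous_iter => //; apply: ext_mono_span => /=.
Qed.

End ExteriorGradings.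

(** * Matrix entries and scores *)

Section Indices.
Variable n : nat.
Local Notation index := ('I_n * 'I_n)%type.
Implicit Types (a b c : 'I_n) (t : index).

Lemma ord_mod_proof a (m : nat) : (m %% n < n)%N.
Proof. by rewrite ltn_pmod // (leq_ltn_trans (leq0n _) (ltn_ord a)). Qed.

(* The generator of index t is the matrix entry in row [src t], column [tgt t]. *)
Definition src t : 'I_n := t.2.
Definition tgt t : 'I_n := Ordinal (ord_mod_proof t.2 (t.2 + t.1.+1)).
(** The first component is b - a - 1 modulo n, so the diagonal entries are the generators
    h_(n,j). *)
Definition ix a b : index := (Ordinal (ord_mod_proof a (b + (n - a.+1))), a).

Lemma src_ix a b : src (ix a b) = a. Proof. by []. Qed.

Lemma tgt_ix a b : tgt (ix a b) = b.
Proof.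
apply: val_inj; rewrite /= -addn1 addnCA modnDml.
have -> : (b + (n - a.+1) + (a + 1) = b + n)%N by have := ltn_ord a; lia.
by rewrite modnDr modn_small.
Qed.

Lemma ixK t : ix (src t) (tgt t) = t.
Proof.
case: t => i j; congr pair; apply: val_inj => /=; rewrite modnDml.
have -> : (j + i.+1 + (n - j.+1) = i + n)%N by have := ltn_ord j; lia.
by rewrite modnDr modn_small.
Qed.

Arguments tgt : simpl never.

Lemma ix_inj a b a' b' : ix a b = ix a' b' -> a = a' /\ b = b'.
Proof.
move=> e; split; first by rewrite -(src_ix a b) e.
by rewrite -[LHS](tgt_ix a b) e tgt_ix.
Qed.

Lemma eq_ix a b a' b' : (ix a b == ix a' b') = (a == a') && (b == b').
Proof.
by apply/eqP/andP => [/ix_inj[-> ->]|[/eqP -> /eqP ->]]; split.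
Qed.

Lemma big_index (R : Type) (idx : R) (op : Monoid.com_law idx) (G : index -> R) :
  \big[op/idx]_t G t = \big[op/idx]_a \big[op/idx]_b G (ix a b).
Proof.
rewrite pair_big (reindex (fun q : index => ix q.1 q.2)) //=.
by exists (fun t => (src t, tgt t)) => [[a b]|t] _ /=; rewrite ?tgt_ix ?ixK.
Qed.

Definition up t := (src t < tgt t)%N.

Lemma up_ix a b : up (ix a b) = (a < b)%N.
Proof. by rewrite /up tgt_ix. Qed.

Definition basis_wt a : {ffun 'I_n -> int} := [ffun v => (v == a)%:Z].

Definition up_wt t : {ffun 'I_n -> int} :=
  if up t then basis_wt (src t) - basis_wt (tgt t) else 0.

Lemma wsum_ffun (g : index -> {ffun 'I_n -> int}) S v :
  wsum g S v = wsum (fun t => g t v) S.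
Proof. by rewrite /wsum sum_ffunE. Qed.

Lemma wsum_up_wt S v :
  wsum up_wt S v = \sum_(b : 'I_n | (v < b)%N) (ix v b \in S)%:Z
                   - \sum_(a : 'I_n | (a < v)%N) (ix a v \in S)%:Z.
Proof.
rewrite wsum_ffun /wsum big_mkcond big_index /=.
pose A a b : int := ((ix a b \in S) && (a < b)%N)%:Z.
under eq_bigr => a _. under eq_bigr => b _.
  rewrite /up_wt up_ix tgt_ix src_ix (_ : (if _ then _ else _) =
    (v == a)%:Z * A a b - (v == b)%:Z * A a b); last first.
    rewrite /A; case: (_ \in S); case: ltnP => _;
      by rewrite ?ffunE ?mulr0 ?subrr //= !mulr1.
  over.
  rewrite sumrB -mulr_sumr; over.
rewrite sumrB; congr (_ - _).
  rewrite (bigD1 v) //= eqxx mul1r [X in _ + X]big1 ?addr0 => [|a /negPf av]; last first.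
    by rewrite eq_sym av mul0r.
  rewrite [RHS]big_mkcond; apply: eq_bigr => b _; rewrite /A.
  by case: ifP; rewrite ?andbT ?andbF.
rewrite [RHS]big_mkcond; apply: eq_bigr => a _.
rewrite (bigD1 v) //= eqxx mul1r [X in _ + X]big1 ?addr0 => [|b /negPf bv]; last first.
  by rewrite eq_sym bv mul0r.
by rewrite /A; case: ifP; rewrite ?andbT ?andbF.
Qed.

(** For a < b let a beat b if [ix a b] is in the set, and b beat a otherwise. The number of
    victories of v is then its score: v for the empty set, corrected by the weight. *)
Definition score (c : {ffun 'I_n -> int}) (v : 'I_n) : int := v%:Z + c v.

Lemma sum_ord_lt (v : 'I_n) : \sum_(a : 'I_n | (a < v)%N) (1 : int) = v%:Z.
Proof.
rewrite -(big_ord_widen n (fun _ => 1 : int)) ?sumr_const ?card_ord ?natz //.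
exact: ltnW.
Qed.

Lemma score_bounds (S : {set index}) v : 0 <= score (wsum up_wt S) v < n%:Z.
Proof.
rewrite /score wsum_up_wt -sum_ord_lt addrCA -sumrB.
have lo1 : 0 <= \sum_(b : 'I_n | (v < b)%N) (ix v b \in S)%:Z.
  by apply: sumr_ge0 => b _.
have lo2 : 0 <= \sum_(a : 'I_n | (a < v)%N) (1 - (ix a v \in S)%:Z).
  by apply: sumr_ge0 => a _; case: (_ \in S).
have hi1 : \sum_(b : 'I_n | (v < b)%N) (ix v b \in S)%:Z <=
    \sum_(b : 'I_n | (v < b)%N) 1.
  by apply: ler_sum => b _; case: (_ \in S).
have hi2 : \sum_(a : 'I_n | (a < v)%N) (1 - (ix a v \in S)%:Z) <=
    \sum_(b : 'I_n | (b < v)%N) 1.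
  by apply: ler_sum => a _; case: (_ \in S).
have tot : n%:Z = \sum_(b : 'I_n | (v < b)%N) 1 + (\sum_(b : 'I_n | (b < v)%N) 1 + 1).
  rewrite -[LHS]natz -{1}(card_ord n) -sumr_const (bigD1 v) //= [RHS]addrA addrC.
  congr (_ + _); rewrite (bigID (fun b : 'I_n => (v < b)%N)) /=.
  by congr (_ + _); apply: eq_bigl => b; rewrite -(inj_eq val_inj) /=; lia.
rewrite addr_ge0 //= tot.
by rewrite addrA ltzD1 lerD.
Qed.

End Indices.

(** * The strictly upper triangular differential *)

Lemma ext_deriv_even (F : fieldType) (I : finType) (G : I -> ext F I) x y :
  (forall s, G s \in ext_homog F I 1) ->
  ext_deriv G (x * y) = ext_deriv G x * y + x * ext_deriv G y.
Proof.
move=> G1; rewrite (ext_sum x) mulr_suml !linear_sum !mulr_suml -big_split /=.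
apply: eq_bigr => S _; rewrite -!scalerAl !linearZ /= -!scalerAl -scalerDr.
congr (_ *: _); rewrite ext_monoE; elim: (enum S) => [|t w IHw].
  by rewrite big_nil !mul1r ext_deriv1 mul0r add0r.
rewrite big_cons -mulrA !ext_deriv_genM_even // IHw !mulrDr !mulrDl.
by rewrite addrA !mulrA.
Qed.

Section UpDifferential.
Variables (F : fieldType) (n : nat).
Local Notation index := ('I_n * 'I_n)%type.
Local Notation Lambda := (ext F index).
Implicit Types (a b c v : 'I_n) (t : index).

Definition entry a b : Lambda := ext_gen F (ix a b).
Definition upper a b : Lambda := if (a < b)%N then entry a b else 0.

Arguments upper : simpl never.

(** The Chevalley-Eilenberg differential of the strictly upper triangular matrices; it vanishes on
    the other generators. *)
Definition up_diff_gen t : Lambda := \sum_c upper (src t) c * upper c (tgt t).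
Definition up_diff : 'End(Lambda) := ext_deriv up_diff_gen.

Lemma upper_homog a b : upper a b \in ext_homog F _ 1.
Proof. by rewrite /upper; case: ifP => _; rewrite ?mem0v ?ext_gen_homog. Qed.

Lemma upper_anti a b c d : upper a b * upper c d = - (upper c d * upper a b).
Proof.
rewrite /upper; case: ifP; case: ifP => _ _; rewrite ?mul0r ?mulr0 ?oppr0 //.
exact: ext_gen_anti.
Qed.

Lemma upper_diff a b : ~~ (a < b)%N -> \sum_c upper a c * upper c b = 0.
Proof.
move=> ab; rewrite big1 // => c _; rewrite /upper.
case: ltnP => ac; last by rewrite mul0r.
case: ltnP => cb; last by rewrite mulr0.
by rewrite (ltn_trans ac cb) in ab.
Qed.

Lemma up_diff_gen_homog t : up_diff_gen t \in ext_homog F _ 2.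
Proof.
by apply: memv_suml => c _; apply: (ext_homogM (upper_homog _ _) (upper_homog _ _)).
Qed.

Lemma up_diff_upper a b : up_diff (upper a b) = \sum_c upper a c * upper c b.
Proof.
rewrite {1}/upper; case: ifPn => ab; last by rewrite linear0 upper_diff.
by rewrite ext_deriv_gen ?/up_diff_gen ?src_ix ?tgt_ix //; apply: up_diff_gen_homog.
Qed.

Lemma up_diff_leibniz k x y : x \in ext_homog F _ k ->
  up_diff (x * y) = up_diff x * y + (-1) ^+ k *: (x * up_diff y).
Proof. by apply: ext_leibniz; apply: up_diff_gen_homog. Qed.

Lemma up_diff_sq0 x : up_diff (up_diff x) = 0.
Proof.
apply: ext_deriv_sq0 => [|t]; first exact: up_diff_gen_homog.
rewrite -/up_diff linear_sum /=.
under eq_bigr => c _.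
  rewrite (up_diff_leibniz _ (upper_homog _ _)) expr1 scaleN1r !up_diff_upper.
  rewrite mulr_suml mulr_sumr; over.
rewrite sumrB exchange_big /=; apply/eqP; rewrite subr_eq0; apply/eqP.
by apply: eq_bigr => c _; apply: eq_bigr => c' _; rewrite mulrA.
Qed.

Lemma up_diff_homogeneous (M : zmodType) (g : index -> M) k :
  (forall a c b, (a < c)%N -> (c < b)%N ->
    g (ix a c) + g (ix c b) = g (ix a b) + k) -> homogeneous g up_diff k.
Proof.
move=> gk; apply: homogeneous_deriv => t; apply: memv_suml => c _; rewrite /upper.
case: ltnP => ac; last by rewrite mul0r mem0v.
case: ltnP => cb; last by rewrite mulr0 mem0v.
have := hspanM (ext_gen_hspan F g (ix (src t) c)) (ext_gen_hspan F g (ix c (tgt t))).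
by rewrite (gk _ _ _ ac cb) ixK.
Qed.

Lemma up_wt_ix a b : (a < b)%N -> up_wt (ix a b) = basis_wt a - basis_wt b.
Proof. by move=> ab; rewrite /up_wt up_ix ab src_ix tgt_ix. Qed.

Lemma up_diff_wt : homogeneous (@up_wt n) up_diff 0.
Proof.
apply: up_diff_homogeneous => a c b ac cb; rewrite !up_wt_ix ?(ltn_trans ac cb) //.
by rewrite addr0 addrA subrK.
Qed.

(** * The sl_2 operators attached to two neighbouring indices *)

Section AdjacentPair.
Variables (s s' : 'I_n).
Hypothesis s'E : s' = s.+1 :> nat.

Let ss' : (s < s')%N. Proof. by rewrite s'E. Qed.

Local Notation "[ 'if' P ]" := ((P : bool)%:R : F) (at level 0, P at level 99).

Let x0 := upper s s'.

(** The entries of the commutator of the elementary matrix E_s's with the matrix of generators, cut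
    off to the strictly upper triangle. *)
Definition lower_gen t : Lambda :=
  if up t then [if src t == s'] *: upper s (tgt t)
               - [if tgt t == s] *: upper (src t) s'
  else 0.

Definition lower : 'End(Lambda) := ext_deriv lower_gen.

Lemma lower_gen_homog t : lower_gen t \in ext_homog F _ 1.
Proof.
rewrite /lower_gen; case: ifP => _; last exact: mem0v.
by rewrite memvB // memvZ // upper_homog.
Qed.

Lemma lower_leibniz x y : lower (x * y) = lower x * y + x * lower y.
Proof. exact/ext_deriv_even/lower_gen_homog. Qed.

Lemma lower_ext_gen t : lower (ext_gen F t) = lower_gen t.
Proof.
rewrite -[ext_gen F t]mulr1 ext_deriv_genM_even ?mulr1; last exact: lower_gen_homog.
by rewrite ext_deriv1 mulr0 addr0.
Qed.

Local Ltac simp_coef :=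
  rewrite /= ?(mulr0n, mulr1n, mul0r, mulr0, mulr1, mul1r, scale0r, scale1r,
    scaleN1r, scaler0, subr0, sub0r, oppr0, addr0, add0r, opprK, subrr).

(* The last term corrects the commutator [E_s's, -], which leaves the strictly
   upper triangular matrices at the two diagonal entries. *)
Lemma lower_upper a b : lower (upper a b) =
  [if a == s'] *: upper s b - [if b == s] *: upper a s'
  - ([if a == s'] * [if b == s'] - [if a == s] * [if b == s]) *: x0.
Proof.
rewrite {1}/upper; case: ltnP => ab.
  rewrite lower_ext_gen /lower_gen up_ix src_ix tgt_ix ab.
  have nos' : (a == s') && (b == s') = false.
    by apply/andP => -[/eqP as' /eqP bs']; rewrite as' bs' ltnn in ab.
  have nos : (a == s) && (b == s) = false.
    by apply/andP => -[/eqP as' /eqP bs']; rewrite as' bs' ltnn in ab.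
  by rewrite -!natrM !mulnb nos nos' subrr scale0r subr0.
have U (p q : 'I_n) : (q <= p)%N -> upper p q = 0.
  by move=> qp; rewrite /upper ltnNge qp.
have nes : (s' == s) = false by rewrite -(inj_eq val_inj) /= s'E eqn_leq ltnn.
rewrite linear0; have [as'|as'] := eqVneq a s'; rewrite ?as' ?nes /=.
  have [->|bs'] := eqVneq b s'; rewrite ?nes.
    by simp_coef.
  simp_coef; rewrite !U // ?(scaler0, subr0) //.
  have bs'' : b != s' :> nat by [].
  rewrite as' in ab; clear -ab s'E bs''. lia.
have [bs|bs] := eqVneq b s; last by simp_coef.
have [as_|as_] := eqVneq a s.
  by rewrite as_; simp_coef.
simp_coef; rewrite U ?oppr0 //.
have as1 : a != s :> nat by [].
have as2 : a != s' :> nat by [].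
rewrite bs in ab; lia.
Qed.

(** Minus the coroot of the pair, so that the generator [x0] has weight -2. *)
Definition pair_coef t : int := up_wt t s' - up_wt t s.

Lemma up_diff_x0 : up_diff x0 = 0.
Proof.
rewrite up_diff_upper big1 // => c _; rewrite /upper.
case: ltnP => sc; last by rewrite mul0r.
by case: ltnP => cs; rewrite ?mulr0 //; lia.
Qed.

Lemma sum_eqr (G : 'I_n -> Lambda) v : \sum_c [if c == v] *: G c = G v.
Proof.
rewrite (bigD1 v) //= eqxx scale1r big1 ?addr0 // => c /negPf ->.
by rewrite scale0r.
Qed.

Lemma sum_eqr2 p q (G : 'I_n -> Lambda) :
  \sum_c (p * [if c == s'] - q * [if c == s]) *: G c = p *: G s' - q *: G s.
Proof.
under eq_bigr => c _ do rewrite scalerBl -!scalerA.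
by rewrite sumrB -!scaler_sumr !sum_eqr.
Qed.

Lemma sum_eql2 p q (G : 'I_n -> Lambda) :
  \sum_c ([if c == s'] * p - [if c == s] * q) *: G c = p *: G s' - q *: G s.
Proof. by rewrite -sum_eqr2; apply: eq_bigr => c _; rewrite !(mulrC [if _]). Qed.

(** The differential squares the matrix of generators, and the commutator with E_s's is a derivation
    for matrix products. What remains are the two diagonal corrections of [lower_upper], multiples
    of the cocycle [x0]. *)
Lemma lower_up_diff_upper a b :
  lower (up_diff (upper a b)) =
    up_diff (lower (upper a b))
    - ([if a == s'] - [if a == s] - [if b == s'] + [if b == s]) *: (x0 * upper a b).
Proof.
rewrite up_diff_upper linear_sum /=.
under eq_bigr => c _.
  rewrite lower_leibniz !lower_upper !mulrBl !mulrBr -!scalerAl -!scalerAr.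
  over.
rewrite !big_split /= !sumrN -!scaler_sumr !sum_eqr.
rewrite (sum_eqr2 [if a == s'] [if a == s] (fun c => x0 * upper c b)).
rewrite (sum_eql2 [if b == s'] [if b == s] (fun c => upper a c * x0)).
have UZ k u : up_diff (k *: u) = k *: up_diff u by rewrite linearZ.
rewrite lower_upper !(linearB up_diff) /= !UZ up_diff_x0 scaler0 subr0 !up_diff_upper.
rewrite /x0 !(upper_anti a _ s s') -/x0.
have E (G : 'I_n -> Lambda) u v : [if u == v] *: G v = [if u == v] *: G u.
  by case: eqVneq => [->|]; rewrite ?scale0r.
rewrite (E (fun c => x0 * upper c b) a s') (E (fun c => x0 * upper c b) a s).
rewrite (E (fun c => - (x0 * upper a c)) b s') (E (fun c => - (x0 * upper a c)) b s).
rewrite !scalerDl !scaleNr !scalerN.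
move: (_ *: \sum_c _) (_ *: \sum_c _) (upper a s' * upper s b) => A B D.
move: (_ *: (x0 * _)) (_ *: (x0 * _)) (_ *: (x0 * _)) (_ *: (x0 * _)) => p q r t.
by rewrite addrACA -opprD addrA subrK opprK !addrA.
Qed.

Lemma lower_up_diff_gen t :
  up_diff (lower_gen t) =
    lower (up_diff_gen t) + (pair_coef t)%:~R *: (x0 * ext_gen F t).
Proof.
rewrite -(ixK t); move: (src t) (tgt t) => a b; rewrite /pair_coef /up_wt up_ix.
have [ab|ba] := ltnP a b; last first.
  rewrite /lower_gen up_ix ltnNge ba /= linear0 /up_diff_gen src_ix tgt_ix.
  by rewrite upper_diff -?leqNgt // linear0 !ffunE subrr scale0r addr0.
have abE : ext_gen F (ix a b) = upper a b by rewrite /upper ab.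
have -> : up_diff_gen (ix a b) = up_diff (upper a b).
  by rewrite up_diff_upper /up_diff_gen tgt_ix.
rewrite -lower_ext_gen abE lower_up_diff_upper -addrA.
rewrite -[LHS]addr0; congr (_ + _); rewrite -scaleNr -scalerDl src_ix tgt_ix !ffunE.
rewrite (_ : _ + _ = 0) ?scale0r // !rmorphB /= !pmulrn.
rewrite (eq_sym s' a) (eq_sym s a) (eq_sym s' b) (eq_sym s b).
ring.
Qed.

Let t0 := ix s s'.

Let x0E : x0 = ext_gen F t0. Proof. by rewrite /x0 /upper ss'. Qed.

Let up_wt_t0 : up_wt t0 = basis_wt s - basis_wt s'.
Proof. exact: up_wt_ix. Qed.

Lemma lower_homogeneous (M : zmodType) (g : index -> M) k :
  (forall b, (s' < b)%N -> g (ix s b) = g (ix s' b) + k) ->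
  (forall a, (a < s)%N -> g (ix a s') = g (ix a s) + k) ->
  homogeneous g lower k.
Proof.
move=> gs gs'; apply: homogeneous_deriv => t; rewrite /lower_gen.
rewrite -(ixK t) up_ix src_ix tgt_ix; move: (src t) (tgt t) => a b.
case: ifP => ab; last exact: mem0v.
rewrite memvB //.
  have [as'|_] := eqVneq a s'; last by rewrite scale0r mem0v.
  rewrite scale1r /upper; case: ifP => _; last exact: mem0v.
  by move: ab; rewrite as' => /gs <-; apply: ext_gen_hspan.
have [bs|_] := eqVneq b s; last by rewrite scale0r mem0v.
rewrite scale1r /upper; case: ifP => _; last exact: mem0v.
by move: ab; rewrite bs => /gs' <-; apply: ext_gen_hspan.
Qed.

Lemma lower_wt : homogeneous (@up_wt n) lower (basis_wt s - basis_wt s').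
Proof.
apply: lower_homogeneous => [b sb|a sa];
  rewrite !up_wt_ix ?(ltn_trans ss') ?(ltn_trans _ ss') //.
  by rewrite [in RHS]addrC addrA subrK.
by rewrite addrA subrK.
Qed.

Local Notation gen_mul0 := (gen_mul F t0).
Local Notation gen_contr0 := (gen_contr F t0).
Local Notation pair_wt := (ext_weight F pair_coef).

Let pair_morph : {morph (fun c : {ffun 'I_n -> int} => c s' - c s) : x y / x + y}.
Proof. by move=> x y; rewrite !ffunE opprD addrACA. Qed.

Let pair_t0 : pair_coef t0 = - 2%:R.
Proof.
rewrite /pair_coef up_wt_t0 !ffunE !eqxx (eq_sym s' s) (_ : (s == s') = false) //.
by rewrite -(inj_eq val_inj) /= (ltn_eqF ss').
Qed.

Lemma reflection_relations : [/\
  forall x, gen_contr0 (gen_mul0 x) = x - gen_mul0 (gen_contr0 x),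
  forall x, gen_mul0 (gen_mul0 x) = 0,
  forall x, gen_contr0 (gen_contr0 x) = 0,
  forall x, up_diff (gen_mul0 x) = - gen_mul0 (up_diff x) &
  forall x, lower (gen_mul0 x) = gen_mul0 (lower x)].
Proof.
split=> x; rewrite ?gen_mulE ?gen_contrE ?gen_mulE.
- by rewrite ext_contr_gen eqxx scale1r.
- by rewrite mulrA ext_gen_sq mul0r.
- by apply/ffunP => U; rewrite !ffunE setU11 mulr0 if_same.
- rewrite ext_deriv_genM; last exact: up_diff_gen_homog.
  suff -> : up_diff_gen t0 = 0 by rewrite mul0r sub0r.
  by rewrite -[LHS](ext_deriv_gen up_diff_gen_homog) -/up_diff -x0E up_diff_x0.
- have ss0 : (s == s') = false by rewrite -(inj_eq val_inj) /= (ltn_eqF ss').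
  rewrite lower_leibniz -x0E lower_upper ss0 (eq_sym s' s) ss0.
  by rewrite /= !mulr0n ?(subrr, mul0r, mulr0, oppr0, scale0r, subr0, add0r).
Qed.

Lemma contr_upper a b y : ~~ ((a == s) && (b == s')) ->
  gen_contr0 (upper a b * y) = - (upper a b * gen_contr0 y).
Proof.
rewrite !gen_contrE /upper; case: ifP => _ ab; last by rewrite !mul0r linear0 oppr0.
by rewrite ext_contr_gen eq_ix ![s == _]eq_sym ![s' == _]eq_sym (negPf ab) scale0r sub0r.
Qed.

(** No [lower_gen t] contains [x0]: it could only come from a diagonal entry. *)
Lemma lower_contr x : lower (gen_contr0 x) = gen_contr0 (lower x).
Proof.
have lc t y : gen_contr0 (lower_gen t * y) = - (lower_gen t * gen_contr0 y).
  rewrite /lower_gen; case: ifP => ut; last by rewrite !mul0r linear0 oppr0.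
  rewrite !mulrBl linearB /= -!scalerAl !linearZ /= opprD.
  congr (_ + _).
    have [us|_] := eqVneq (src t) s'; last by rewrite !scale0r oppr0.
    rewrite !scale1r contr_upper //; apply/andP => -[_ /eqP ts].
    by move: ut; rewrite /up us ts ltnn.
  have [us|_] := eqVneq (tgt t) s; last by rewrite !scale0r oppr0.
  rewrite !scale1r contr_upper //; apply/andP => -[/eqP ts _].
  by move: ut; rewrite /up us ts ltnn.
rewrite -!comp_lfunE; move: x; apply: ext_lfun_ind => [|t x].
  by rewrite !comp_lfunE !gen_contrE ext_contr1 [lower 1]ext_deriv1 !linear0.
rewrite !comp_lfunE => IH.
have cE y : gen_contr0 (ext_gen F t * y) =
    (t0 == t)%:R *: y - ext_gen F t * gen_contr0 y.
  by rewrite !gen_contrE ext_contr_gen.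
have lE y : lower (ext_gen F t * y) = lower_gen t * y + ext_gen F t * lower y.
  exact/ext_deriv_genM_even/lower_gen_homog.
rewrite lE (linearD gen_contr0) /= lc !cE linearB linearZ /= lE -IH.
by rewrite opprD addrCA.
Qed.

(** Both sides obey the same rule under left multiplication by a generator, which reduces the
    identity to [lower_up_diff_gen]. *)
Lemma up_diff_lower x :
  up_diff (lower x) = lower (up_diff x) + gen_mul0 (pair_wt x).
Proof.
rewrite -!comp_lfunE -add_lfunE; move: x; apply: ext_lfun_ind => [|t x].
  rewrite add_lfunE !comp_lfunE !ext_deriv1 !linear0 add0r.
  rewrite (ext_weightE (c := 0)) ?scale0r ?linear0 //.
  by apply: ext_mono_span; rewrite /wsum big_set0.
rewrite !add_lfunE !comp_lfunE => IH.
rewrite ext_deriv_genM_even; last exact: lower_gen_homog.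
rewrite linearD /= (up_diff_leibniz _ (lower_gen_homog t)) expr1 scaleN1r.
rewrite !ext_deriv_genM; try exact: up_diff_gen_homog.
rewrite IH linearB /= lower_leibniz lower_leibniz lower_ext_gen lower_up_diff_gen.
rewrite -(gen_mulE t x) (ext_weight_homogeneous _ (homogeneous_mul F pair_coef t)).
rewrite !gen_mulE -x0E mulrDl -scalerAl !mulrDr -scalerAr -/lower -/up_diff.
have -> : x0 * (ext_gen F t * pair_wt x) = - (ext_gen F t * (x0 * pair_wt x)).
  by rewrite !mulrA x0E ext_gen_anti mulNr.
rewrite [x0 * (_ * x)]mulrA !opprD.
move: (lower (up_diff_gen t) * x) (_ *: (x0 * ext_gen F t * x)) => A B.
move: (lower_gen t * up_diff x) (up_diff_gen t * lower x) => C D.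
move: (ext_gen F t * lower _) (ext_gen F t * (x0 * _)) => E G.
by rewrite [A + D + _]addrACA [A + B - C]addrAC -!addrA [B + _]addrC !addrA.
Qed.

Lemma pair_relations : [/\
  forall x, pair_wt (up_diff x) = up_diff (pair_wt x),
  forall x, pair_wt (gen_mul0 x) = gen_mul0 (pair_wt x) - 2%:R *: gen_mul0 x,
  forall x, pair_wt (gen_contr0 x) = gen_contr0 (pair_wt x) + 2%:R *: gen_contr0 x &
  forall x, pair_wt (lower x) = lower (pair_wt x) - 2%:R *: lower x].
Proof.
have low2 : homogeneous pair_coef lower (- 2%:R).
  rewrite -pair_t0 /pair_coef up_wt_t0.
  exact: homogeneous_morph pair_morph lower_wt.
have up0 : homogeneous pair_coef up_diff 0.
  by have := homogeneous_morph pair_morph up_diff_wt; rewrite !ffunE subrr.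
have mul2 := homogeneous_mul F pair_coef t0.
have con2 := homogeneous_contr F pair_coef t0.
split=> x.
- by rewrite (ext_weight_homogeneous _ up0) scale0r addr0.
- by rewrite (ext_weight_homogeneous _ mul2) pair_t0 mulrNz scaleNr.
- by rewrite (ext_weight_homogeneous _ con2) pair_t0 opprK.
- by rewrite (ext_weight_homogeneous _ low2) mulrNz scaleNr.
Qed.

(** Both operators shift the weight at [s] by one, and [score_bounds] limits the spread of that
    weight. *)
Lemma nilpotency_relations x :
  iter n (raising up_diff gen_contr0) x = 0 /\ iter n lower x = 0.
Proof.
have ne : (s == s') = false by rewrite -(inj_eq val_inj) /= (ltn_eqF ss').
have bound S T : wsum (fun t => up_wt t s) S - wsum (fun t => up_wt t s) T < n%:Z.
  rewrite -!wsum_ffun; have := score_bounds S s; have := score_bounds T s.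
  rewrite /score; move: (wsum (@up_wt n) S s) (wsum (@up_wt n) T s) => A B.
  by move=> /andP[lo hi] /andP[lo' hi']; lia.
pose ev (c : {ffun 'I_n -> int}) := c s.
have evD : {morph ev : x y / x + y} by move=> y z; rewrite /ev ffunE.
pose evN (c : {ffun 'I_n -> int}) := - c s.
have evND : {morph evN : x y / x + y} by move=> y z; rewrite /evN ffunE opprD.
split.
  apply: (homogeneous_nilpotent (g := fun t => ev (up_wt t))) => //.
  have ev1 : ev (up_wt t0) = 1 by rewrite up_wt_t0 /ev !ffunE eqxx ne.
  have con : homogeneous (fun t => ev (up_wt t)) gen_contr0 (-1).
    by rewrite -ev1; apply: (homogeneous_contr F (fun t => ev (up_wt t))).
  have upd : homogeneous (fun t => ev (up_wt t)) up_diff 0.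
    by have := homogeneous_morph evD up_diff_wt; rewrite /ev !ffunE.
  apply: homogeneousD.
    by have := homogeneous_comp upd con; rewrite addr0.
  by have := homogeneous_comp con upd; rewrite add0r.
apply: (homogeneous_nilpotent (g := fun t => evN (up_wt t))).
  have -> : -1 = evN (basis_wt s - basis_wt s').
    by rewrite /evN !ffunE eqxx ne subr0.
  exact: homogeneous_morph evND lower_wt.
move=> S T; have := bound T S; rewrite /wsum /evN !sumrN.
by rewrite opprK addrC.
Qed.

Definition acyclic (c : {ffun 'I_n -> int}) := forall z : Lambda,
  z \in hspan F (@up_wt n) c ->
  up_diff z = 0 -> exists y, up_diff y = z.

(** If the scores differ by m, [pair_wt] acts on weight c by m - 1, so the reflection lemmas apply
    with k = m + 1. The reflected cocycle has the weight in which the two scores are exchanged. *)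
Lemma acyclic_reflection (c : {ffun 'I_n -> int}) :
  (forall j, (0 < j < 3 * n)%N -> j%:R != 0 :> F) ->
  score c s <= score c s' ->
  (score c s < score c s' ->
     acyclic (c + (basis_wt s - basis_wt s') *~ (score c s' - score c s))) ->
  acyclic c.
Proof.
move=> nz cs cs_acyclic z zc az.
have [->|z_neq0] := eqVneq z 0; first by exists 0; rewrite linear0.
have [S /eqP Sc] : exists S, wsum (@up_wt n) S == c.
  apply/existsP; apply: contraR z_neq0 => /existsPn Sc; apply/eqP.
  by apply: hspan_eq0 zc => S; apply: Sc.
have := score_bounds S s; have := score_bounds S s'; rewrite Sc => bs' bs.
have [m mE] : exists m : nat, score c s' - score c s = m.
  by exists `|score c s' - score c s|%N; lia.
have scores : c s' - c s = m%:Z - 1 by move: mE; rewrite /score s'E; lia.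
(* Scores lie in 0, ..., n - 1, so m < n and m + 1 + 2n is at most 3n. *)
have nz' j : (0 < j < m.+1 + 2 * n)%N -> j%:R != 0 :> F.
  by move=> hj; apply: nz; lia.
have [iX XX ii aX fX] := reflection_relations.
have [Ha HX Hi Hf] := pair_relations.
have rN x := proj1 (nilpotency_relations x).
have fN x := proj2 (nilpotency_relations x).
have Hc d w : w \in hspan F (@up_wt n) d -> pair_wt w = (d s' - d s)%:~R *: w.
  move=> wd; apply: ext_weightE; apply: ext_spanS wd => T /eqP <-.
  by rewrite /pair_coef (wsum_morph _ _ pair_morph).
have Hz w : w \in hspan F (@up_wt n) c -> pair_wt w = (m.+1%:R - 2%:R) *: w.
  move/Hc ->; rewrite scores; congr (_ *: _).
  by rewrite rmorphB /= -[m.+1]addn1 natrD -pmulrn; ring.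
have [y yE] := reflection_reduce iX ii lower_contr up_diff_lower Ha Hi Hf rN fN
  nz' isT az (Hz z zc).
(* Projecting the correction to weight c keeps the modified cocycle homogeneous. *)
pose pi d := ext_proj (fun T => wsum (@up_wt n) T == d) : Lambda -> Lambda.
have pi_up d x : up_diff (pi d x) = pi d (up_diff x).
  by rewrite /pi (homogeneous_proj _ _ up_diff_wt) addr0.
set z1 := z - up_diff (pi c y).
have z1E : z1 = pi c (z - up_diff y).
  by rewrite /pi linearB /= -/(pi _ _) -/(pi _ _) -pi_up [pi c z]ext_proj_id.
have z1c : z1 \in hspan F (@up_wt n) c by rewrite z1E; apply: ext_proj_span.
have iz1 : gen_contr0 z1 = 0.
  by rewrite z1E (homogeneous_proj _ _ (homogeneous_contr F _ t0)) yE linear0.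
have az1 : up_diff z1 = 0.
  by rewrite z1E pi_up linearB /= az up_diff_sq0 subrr /pi linear0.
have [|w wE] := reflection_exact iX XX ii up_diff_sq0 aX lower_contr
  up_diff_lower Ha HX Hi Hf rN fN nz' isT iz1 az1 (Hz z1 z1c); last first.
  by exists (pi c y + w); rewrite linearD /= wE addrC subrK.
move=> m0; have lt_cs : score c s < score c s' by lia.
have := cs_acyclic lt_cs; rewrite mE => {}cs_acyclic.
set c' := c + _ in cs_acyclic; set x' := gen_mul0 _.
have x'c' : x' \in hspan F (@up_wt n) c'.
  have := homogeneous_iter (m.+1 - 2) lower_wt z1c.
  move/(homogeneous_span (homogeneous_mul F (@up_wt n) t0)); rewrite up_wt_t0.
  by rewrite -addrA -mulrSr (_ : (m.+1 - 2).+1 = m) //; lia.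
have ax' : up_diff x' = 0.
  rewrite aX; apply/eqP; rewrite oppr_eq0; apply/eqP.
  elim: (m.+1 - 2)%N => [|j IHj]; first by rewrite az1 linear0.
  by rewrite iterS up_diff_lower (linearD gen_mul0) /= XX addr0 -fX IHj linear0.
have [w wE] := cs_acyclic x' x'c' ax'.
(* The projection makes the primitive an eigenvector of [pair_wt]. *)
exists (pi c' w); first by rewrite pi_up wE /pi ext_proj_id.
rewrite (Hc c') ?ext_proj_span //; congr (_ *: _).
have ne : (s == s') = false by rewrite -(inj_eq val_inj) /= (ltn_eqF ss').
have -> : c' s' - c' s = - (m.+1)%:Z.
  have DE : ((basis_wt s - basis_wt s') *~ m) s'
      - ((basis_wt s - basis_wt s') *~ m) s = - (2 * m)%:Z.
    rewrite -pmulrn !ffunMnE !ffunE !eqxx (eq_sym s' s) ne.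
    by rewrite sub0r subr0 mulNrn !natz; lia.
  rewrite /c' ![(c + _) _]ffunE opprD addrACA DE scores; lia.
by rewrite mulrNz.
Qed.

End AdjacentPair.
End UpDifferential.

(** * Weights with repeated scores *)

Lemma ffun_mulrzE (I : finType) (d : {ffun I -> int}) k v : (d *~ k) v = d v * k.
Proof.
case: k => k; first by rewrite -pmulrn ffunMnE -mulr_natr natz.
by rewrite NegzE mulrNz -pmulrn ffunE ffunMnE mulrN -mulr_natr natz.
Qed.

Section Acyclicity.
Variables (F : fieldType) (n : nat).
Hypothesis nz : forall j, (0 < j < 3 * n)%N -> j%:R != 0 :> F.
Local Notation index := ('I_n * 'I_n)%type.

Lemma score_swap (c : {ffun 'I_n -> int}) s s' v :
  score (c + (basis_wt s - basis_wt s') *~ (score c s' - score c s)) v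
  = score c (tperm s s' v).
Proof.
rewrite /score ffunE ffun_mulrzE !ffunE; case: tpermP => [->|->|vs vs'].
- have [<-|_] := eqVneq s s'; first by rewrite eqxx subrr mul0r addr0.
  by rewrite eqxx subr0 mul1r addrA addrC subrK.
- have [->|_] := eqVneq s' s; first by rewrite eqxx subrr mul0r addr0.
  by rewrite eqxx sub0r mulN1r opprB addrA addrC subrK.
by rewrite (introF eqP vs) (introF eqP vs') subrr mul0r addr0.
Qed.

(** Bubble sort: if some neighbouring scores fail to decrease, they are equal, or exchanging them
    lowers the sum of v times its score, which stays non-negative. Strictly decreasing scores would
    be injective. *)
Lemma acyclic_noninjective (c : {ffun 'I_n -> int}) :
  ~ injective (score c) -> acyclic F c.
Proof.
move=> c_inj z zc az.
have [->|z_neq0] := eqVneq z 0; first by exists 0; rewrite linear0.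
have [S /eqP Sc] : exists S, wsum (@up_wt n) S == c.
  apply/existsP; apply: contraR z_neq0 => /existsPn Sc; apply/eqP.
  by apply: hspan_eq0 zc => S; apply: Sc.
have c_ge0 v : 0 <= score c v by have := score_bounds S v; rewrite Sc => /andP[].
have [m cm] : exists m : nat, \sum_(v < n) v%:Z * score c v < m%:Z.
  exists `|(\sum_(v < n) v%:Z * score c v + 1)%R|%N; rewrite abszE.
  by rewrite (lt_le_trans _ (ler_norm _)) // ltrDl.
move: z zc az {S Sc z_neq0}; rewrite -/(acyclic F c).
elim: m c c_inj c_ge0 cm => [|m IHm] c c_inj c_ge0 cm.
  have : 0 <= \sum_(v < n) v%:Z * score c v.
    by apply: sumr_ge0 => v _; rewrite mulr_ge0.
  by rewrite leNgt cm.
have [/existsP[s /existsP[s' /andP[/eqP s'E le_ss']]]|] := boolP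
    [exists s : 'I_n, exists s' : 'I_n,
       (s' == s.+1 :> nat) && (score c s <= score c s')]; last first.
  move/existsPn => dec; case: c_inj.
  have {}dec (s s' : 'I_n) : s' = s.+1 :> nat -> score c s' < score c s.
    move=> s'E; have /existsPn/(_ s') := dec s.
    by rewrite s'E eqxx /= -ltNge.
  have dec' k (a b : 'I_n) : b = (a + k.+1)%N :> nat -> score c b < score c a.
    elim: k b => [|k IHk] b bE; first by apply: dec; rewrite bE addn1.
    have lt_b' : (a + k.+1 < n)%N by have := ltn_ord b; lia.
    apply: lt_trans (IHk (Ordinal lt_b') erefl).
    by apply: dec; rewrite bE /= addnS.
  move=> a b ab; apply: val_inj; case: (ltngtP a b) => // lt_ab.
    have := @dec' (b - a).-1 a b; rewrite ab ltxx => H.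
    by have /H : b = (a + (b - a).-1.+1)%N :> nat by lia.
  have := @dec' (a - b).-1 b a; rewrite ab ltxx => H.
  by have /H : a = (b + (a - b).-1.+1)%N :> nat by lia.
apply: (acyclic_reflection s'E nz le_ss') => lt_ss'; apply: IHm => [inj'|v|].
- apply: c_inj => a b ab; apply: (@perm_inj _ (tperm s s')); apply: inj'.
  by rewrite !score_swap !tpermK.
- by rewrite score_swap.
set k := score c s' - score c s.
have -> : \sum_(v < n) v%:Z * score (c + (basis_wt s - basis_wt s') *~ k) v
    = \sum_(v < n) v%:Z * score c v - k.
  under eq_bigr => v _ do rewrite /score ffunE ffun_mulrzE addrA mulrDr !ffunE.
  rewrite big_split /=; congr (_ + _).
  have delta_sum (u : 'I_n) (x : int) : \sum_(v < n) (v == u)%:Z * x = x.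
    rewrite (bigD1 u) //= eqxx mul1r big1 ?addr0 // => v /negPf ->.
    by rewrite mul0r.
  have E v : v%:Z * (((v == s)%:Z - (v == s')%:Z) * k) =
      (v == s)%:Z * (s%:Z * k) - (v == s')%:Z * (s'%:Z * k) :> int.
    by have [->|_] := eqVneq v s;
      [have [->|_] := eqVneq s s' | have [->|_] := eqVneq v s']; rewrite /=; lia.
  under eq_bigr => v _ do rewrite E.
  by rewrite sumrB !delta_sum s'E; lia.
have : 0 < k by rewrite subr_gt0.
by move: cm; rewrite -addn1; lia.
Qed.

End Acyclicity.

(** * Tournaments determined by their scores *)

Section Tournaments.
Variable n : nat.
Local Notation index := ('I_n * 'I_n)%type.
Implicit Types (A : 'I_n -> 'I_n -> bool) (nu : 'I_n -> int) (S : {set index}).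

Definition excess A (v : 'I_n) : int :=
  \sum_(b : 'I_n | (v < b)%N) (A v b)%:Z - \sum_(a : 'I_n | (a < v)%N) (A a v)%:Z.

Lemma excess_weighted A nu :
  \sum_(v < n) nu v * excess A v =
  \sum_(a < n) \sum_(b < n | (a < b)%N) (A a b)%:Z * (nu a - nu b).
Proof.
under eq_bigr => v _ do rewrite mulrBr !mulr_sumr.
rewrite sumrB [X in _ - X](exchange_big_dep predT) //= -sumrB.
apply: eq_bigr => a _; rewrite -sumrB; apply: eq_bigr => b _.
by rewrite mulrBr mulrC; congr (_ - _); rewrite mulrC.
Qed.

(** An injective map to 0, ..., n - 1 is a permutation, so each value is its own rank. *)
Lemma score_rank nu v : injective nu -> (forall u, 0 <= nu u < n%:Z) ->
  \sum_(u < n | nu u < nu v) 1 = nu v.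
Proof.
move=> nu_inj nu_bd.
have lt_nu u : (`|nu u| < n)%N by have := nu_bd u; lia.
pose f u := Ordinal (lt_nu u).
have f_inj : injective f.
  move=> u w /(congr1 val) /= e; apply: nu_inj.
  by have := nu_bd u; have := nu_bd w; lia.
have -> : nu v = (f v)%:Z by rewrite /=; have := nu_bd v; lia.
rewrite -[RHS]sum_ord_lt [RHS](reindex f) /=; last exact/onW_bij/injF_bij.
by apply: eq_bigl => u; have := nu_bd u; have := nu_bd v; lia.
Qed.

(* The set of inversions of the scores is the unique tournament that maximizes
   the sum of [nu a - nu b] over its edges. *)
Lemma tournament_unique A nu : injective nu -> (forall u, 0 <= nu u < n%:Z) ->
  (forall v, nu v = v%:Z + excess A v) ->
  forall a b : 'I_n, (a < b)%N -> A a b = (nu b < nu a).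
Proof.
move=> nu_inj nu_bd nuE.
pose B a b := nu b < nu a.
have excB v : excess B v = nu v - v%:Z.
  apply/(canRL (addrK _)); rewrite -[RHS](score_rank v nu_inj nu_bd) -sum_ord_lt.
  rewrite /excess -addrA [- _ + _]addrC -sumrB [RHS]big_mkcond /=.
  rewrite [RHS](bigID (fun u : 'I_n => (v < u)%N)) /=; congr (_ + _).
    by apply: eq_bigr => u _; rewrite /B; case: ifP.
  rewrite [RHS](bigD1 v) ?ltnn //= ltxx add0r.
  apply: eq_big => [u|u uv]; first by rewrite -(inj_eq val_inj) /=; lia.
  rewrite /B; case: (ltgtP (nu u) (nu v)) => // /nu_inj uv'.
  by rewrite uv' ltnn in uv.
(* By [excess_weighted] the edge sum depends on the scores alone, which [A] and [B] share. The
   difference has non-negative terms, so each of them vanishes. *)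
have sumE : \sum_(a < n) \sum_(b < n | (a < b)%N)
    ((B a b)%:Z - (A a b)%:Z) * (nu a - nu b) = 0.
  under eq_bigr => a _ do under eq_bigr => b _ do rewrite mulrBl.
  under eq_bigr => a _ do rewrite sumrB.
  rewrite sumrB -!excess_weighted -sumrB big1 // => v _.
  by rewrite excB (nuE v) addrAC subrr add0r subrr.
have term_ge0 a b : 0 <= ((B a b)%:Z - (A a b)%:Z) * (nu a - nu b).
  by rewrite /B; case: (ltrP (nu b) (nu a)) => ab; case: (A a b) => /=; lia.
move=> a b ab.
have /eqP := sumE; rewrite psumr_eq0 => [|i _]; last by apply: sumr_ge0.
move/allP/(_ a (mem_index_enum _))/implyP/(_ isT).
rewrite psumr_eq0 => [|i _ //]; move/allP/(_ b (mem_index_enum _))/implyP/(_ ab).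
rewrite mulf_eq0 => /orP[|].
  by rewrite /B subr_eq0 eqz_nat; case: (A a b); case: (_ < _).
rewrite subr_eq0 => /eqP/nu_inj ab'; by rewrite ab' ltnn in ab.
Qed.

Definition up_sign (t : index) : int :=
  if up t then 1 else if (tgt t < src t)%N then -1 else 0.

Definition full_wt (t : index) : {ffun 'I_n -> int} :=
  basis_wt (src t) - basis_wt (tgt t).

Lemma wsum_full_wt S v :
  wsum full_wt S v = excess (fun a b => ix a b \in S) v
                     - excess (fun a b => ix b a \in S) v.
Proof.
rewrite wsum_ffun /wsum big_mkcond big_index /=.
pose A a b : int := (ix a b \in S)%:Z.
under eq_bigr => a _. under eq_bigr => b _.
  rewrite /full_wt tgt_ix src_ix (_ : (if _ then _ else _) =
    (v == a)%:Z * A a b - (v == b)%:Z * A a b); last first.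
    by rewrite /A; case: (_ \in S); rewrite ?ffunE ?mulr0 ?subrr //= !mulr1.
  over.
  rewrite sumrB -mulr_sumr; over.
rewrite sumrB.
have -> : \sum_(a < n) (v == a)%:Z * \sum_(b < n) A a b = \sum_(b < n) A v b.
  rewrite (bigD1 v) //= eqxx mul1r [X in _ + X]big1 ?addr0 // => a /negPf av.
  by rewrite eq_sym av mul0r.
have -> : \sum_(a < n) \sum_(b < n) (v == b)%:Z * A a b = \sum_(a < n) A a v.
  apply: eq_bigr => a _.
  rewrite (bigD1 v) //= eqxx mul1r [X in _ + X]big1 ?addr0 // => b /negPf bv.
  by rewrite eq_sym bv mul0r.
have split3 (G : 'I_n -> int) : \sum_(u < n) G u =
    \sum_(u < n | (v < u)%N) G u + \sum_(u < n | (u < v)%N) G u + G v.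
  rewrite (bigD1 v) //= addrC; congr (_ + _).
  rewrite (bigID (fun u : 'I_n => (v < u)%N)) /=.
  by congr (_ + _); apply: eq_bigl => u; rewrite -(inj_eq val_inj) /=; lia.
rewrite !split3 /excess /A.
move: (\sum_(_ | _) _) (\sum_(_ | _) _) (\sum_(_ | _) _) (\sum_(_ | _) _) => p q r t.
by lia.
Qed.

Lemma wsum_up_sign S :
  wsum up_sign S = \sum_(a < n) \sum_(b < n | (a < b)%N)
    ((ix a b \in S)%:Z - (ix b a \in S)%:Z).
Proof.
rewrite /wsum big_mkcond big_index /=.
under [RHS]eq_bigr => a _ do rewrite sumrB.
rewrite [RHS]sumrB [X in _ - X](exchange_big_dep predT) //= -sumrB.
apply: eq_bigr => a _; rewrite !(big_mkcond (fun b : 'I_n => (_ < _)%N)) -sumrB.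
apply: eq_bigr => b _; rewrite /up_sign up_ix tgt_ix src_ix.
by case: (ltngtP a b); case: (_ \in S).
Qed.

(** By balance the up generators and the transposed down generators have equal scores. Distinct
    scores would make the two tournaments coincide, and the signs would cancel in pairs. *)
Lemma balanced_noninjective S : wsum full_wt S = 0 -> wsum up_sign S != 0 ->
  ~ injective (score (wsum (@up_wt n) S)).
Proof.
move=> bal sgn inj; set nu := score _ in inj.
have nu_bd u : 0 <= nu u < n%:Z := score_bounds S u.
have nuE v : nu v = v%:Z + excess (fun a b => ix a b \in S) v.
  by rewrite /nu /score wsum_up_wt.
have nuE' v : nu v = v%:Z + excess (fun a b => ix b a \in S) v.
  have /ffunP/(_ v) := bal; rewrite wsum_full_wt ffunE => /eqP.
  by rewrite subr_eq0 nuE => /eqP ->.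
case/eqP: sgn; rewrite wsum_up_sign; apply: big1 => a _; apply: big1 => b ab.
rewrite (tournament_unique inj nu_bd nuE ab).
by rewrite (tournament_unique inj nu_bd nuE' ab) subrr.
Qed.

End Tournaments.

(** * Internal degrees and torus weights *)

Lemma digits_inj p m (f g : nat -> nat) :
  (forall i, f i < p)%N -> (forall i, g i < p)%N ->
  (\sum_(i < m) f i * p ^ i = \sum_(i < m) g i * p ^ i)%N ->
  forall i, (i < m)%N -> f i = g i.
Proof.
elim: m f g => [//|m IHm] f g fp gp.
have E (h : nat -> nat) : (\sum_(i < m.+1) h i * p ^ i =
    h 0 + (\sum_(i < m) h i.+1 * p ^ i) * p)%N.
  rewrite big_ord_recl expn0 muln1 big_distrl /=; congr (_ + _)%N.
  by apply: eq_bigr => i _; rewrite /bump /= expnSr mulnA.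
rewrite !E => e.
have p_gt0 : (0 < p)%N by apply: leq_ltn_trans (fp 0%N).
have e0 : f 0%N = g 0%N.
  by have := congr1 (modn^~ p) e; rewrite ![(_ + _ * p)%N]addnC !modnMDl !modn_small.
move: e; rewrite e0 => /addnI /eqP; rewrite eqn_pmul2r // => /eqP e [//|i].
by rewrite ltnS; apply: (IHm (f \o succn) (g \o succn)) => // j; [apply: fp|apply: gp].
Qed.

(** Digits at most p - 2 keep a number strictly below p^(m+1) - 1, which turns congruences for that
    modulus into equalities. *)
Lemma digits_bound p m (f : nat -> nat) : (forall i, f i + 2 <= p)%N ->
  (\sum_(i < m.+1) f i * p ^ i + 2 <= p ^ m.+1)%N.
Proof.
move=> fp; elim: m => [|m IHm].
  by rewrite big_ord_recl big_ord0 expn0 muln1 addn0 expn1.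
rewrite big_ord_recr /= [(p ^ m.+2)%N]expnS.
have : ((f m.+1 + 1) * p ^ m.+1 <= p * p ^ m.+1)%N.
  by rewrite leq_mul2r; apply/orP; right; have := fp m.+1; lia.
rewrite mulnDl mul1n; move: IHm; move: (p ^ m.+1)%N (\sum_(i < m.+1) _)%N => P s.
by move: (f m.+1 * P)%N (p * P)%N; lia.
Qed.

Section InternalDegree.
Variables (n p : nat).
Hypotheses (n_gt0 : (0 < n)%N) (np : (n + 2 <= p)%N) (p_prime : prime p).
Local Notation index := ('I_n * 'I_n)%type.
Implicit Types (S : {set index}).

Definition degree_count (f : index -> 'I_n) S (v : nat) : nat :=
  \sum_(t in S | f t == v :> nat) 1.

Lemma sum_expn_count (f : index -> 'I_n) S :
  (\sum_(t in S) p ^ f t = \sum_(v < n) degree_count f S v * p ^ v)%N.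
Proof.
rewrite (partition_big f predT) //=; apply: eq_bigr => v _.
rewrite /degree_count big_distrl /=.
by apply: eq_big => [t|t /andP[_ /eqP ->]]; rewrite ?mul1n.
Qed.

Lemma degree_count_src S v : (degree_count (@src n) S v <= n)%N.
Proof.
rewrite /degree_count sum1_card -[leqRHS]card_ord.
rewrite -(card_in_image (f := @tgt n)) ?max_card // => t u.
rewrite !unfold_in => /andP[_ /eqP ts] /andP[_ /eqP us] tu.
rewrite -(ixK t) -(ixK u) tu; congr ix.
exact/val_inj/(etrans ts (esym us)).
Qed.

Lemma degree_count_tgt S v : (degree_count (@tgt n) S v <= n)%N.
Proof.
rewrite /degree_count sum1_card -[leqRHS]card_ord.
rewrite -(card_in_image (f := @src n)) ?max_card // => t u.
rewrite !unfold_in => /andP[_ /eqP ts] /andP[_ /eqP us] tu.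
rewrite -(ixK t) -(ixK u) tu; congr ix.
exact/val_inj/(etrans ts (esym us)).
Qed.

Lemma wsum_full_wt_count S (v : 'I_n) :
  wsum (@full_wt n) S v =
    (degree_count (@src n) S v)%:Z - (degree_count (@tgt n) S v)%:Z.
Proof.
have H f : (degree_count f S v)%:Z = \sum_(t in S) (v == f t)%:Z.
  rewrite /degree_count big_mkcondr /= -natz natr_sum; apply: eq_bigr => t _.
  rewrite (inj_eq val_inj) eq_sym natz; by case: (v == f t).
by rewrite wsum_ffun /wsum !H -sumrB; apply: eq_bigr => t _; rewrite !ffunE.
Qed.

(** The generator in row a and column b has degree 2p(p^b - p^a) up to the modulus; the factor p
    comes from counting subscripts from 1. *)
Lemma mono_ideg_congr S :
  (mono_ideg p S + 2 * (p * \sum_(t in S) p ^ src t)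
   = 2 * (p * \sum_(t in S) p ^ tgt t) %[mod ideg_modulus n p])%N.
Proof.
rewrite /mono_ideg !big_distrr /= -big_split /=.
have H (t : index) : (gen_ideg p t + 2 * (p * p ^ src t) =
    2 * (p * p ^ tgt t) %[mod ideg_modulus n p])%N.
  rewrite /gen_ideg -mulnA -mulnDr /ideg_modulus -!muln_modr; congr (_ * _)%N.
  rewrite mulnBl mul1n -!expnS subnK ?leq_pmull ?expn_gt0 ?prime_gt0 //.
  rewrite -expnD; apply: expn_mod; first exact: prime_gt0.
  have -> : nat_of_ord (tgt t) = ((t.2 + t.1.+1) %% n)%N by [].
  by rewrite -[in RHS]addn1 modnDml; congr (_ %% _)%N; lia.
elim/big_rec2: _ => [|t a b _ IH]; first by [].
by rewrite -modnDm H IH modnDm.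
Qed.

(** Degree zero means that the sums of p^src and of p^tgt agree modulo p^n - 1. Their digits count
    sources and targets and are at most n, so the sums and then the digits are equal. *)
Lemma mono_ideg_eq0 S :
  (mono_ideg p S == 0 %[mod ideg_modulus n p])%N = (wsum (@full_wt n) S == 0).
Proof.
set a := (\sum_(t in S) p ^ src t)%N; set b := (\sum_(t in S) p ^ tgt t)%N.
have p0 := prime_gt0 p_prime.
have lt_mod f : (forall S v, degree_count f S v <= n)%N ->
    (\sum_(t in S) p ^ f t < p ^ n - 1)%N.
  move=> fn; have := @digits_bound p n.-1 (degree_count f S); rewrite prednK //.
  rewrite sum_expn_count => H.
  have {}H := H (fun i => leq_trans (leq_add (fn S i) (leqnn 2)) np).
  lia.
have la : (a < p ^ n - 1)%N := lt_mod _ degree_count_src.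
have lb : (b < p ^ n - 1)%N := lt_mod _ degree_count_tgt.
have cop : coprime (p ^ n - 1) p.
  by rewrite -(@coprime_pexpr n _ _ n_gt0) coprime_sym subn1 coprimenP ?expn_gt0 ?p0.
have -> : (mono_ideg p S == 0 %[mod ideg_modulus n p])%N = (a == b).
  transitivity (2 * (p * a) == 2 * (p * b) %[mod ideg_modulus n p])%N.
    by rewrite -(eqn_modDr (2 * (p * a))%N) mono_ideg_congr add0n eq_sym.
  rewrite /ideg_modulus -!muln_modr eqn_mul2l /=.
  wlog le_ab : a b la lb / (a <= b)%N.
    move=> W; case/orP: (leq_total a b) => ab; first exact: W.
    by rewrite eq_sym [RHS]eq_sym; apply: W.
  rewrite eq_sym eqn_mod_dvd ?leq_pmul2l // -mulnBr Gauss_dvdr //.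
  apply/idP/eqP => [|->]; last by rewrite subnn dvdn0.
  case: (posnP (b - a)) => [|ab0 /(dvdn_leq ab0)]; lia.
have count_p f : (forall S v, degree_count f S v <= n)%N ->
    forall v, (degree_count f S v < p)%N.
  by move=> fn v; apply: leq_ltn_trans (fn S v) _; lia.
apply/eqP/eqP => [ab|w0].
  apply/ffunP => v; rewrite wsum_full_wt_count ffunE.
  apply/eqP; rewrite subr_eq0 eqz_nat; apply/eqP.
  apply: (digits_inj (count_p _ degree_count_src) (count_p _ degree_count_tgt))
    (ltn_ord v).
  by rewrite -!sum_expn_count.
rewrite /a /b !sum_expn_count; apply: eq_bigr => v _; congr (_ * _)%N.
have /ffunP/(_ v) := w0; rewrite wsum_full_wt_count ffunE => /eqP.
by rewrite subr_eq0 eqz_nat => /eqP.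
Qed.

End InternalDegree.

(** * The filtration of the critical complex *)

Section CriticalFiltration.
Variables (F : fieldType) (n : nat).
Local Notation index := ('I_n * 'I_n)%type.
Local Notation Lambda := (ext F index).
Local Notation entry := (@entry F n).
Implicit Types (a b c : 'I_n) (t : index) (S U : {set index}) (x : Lambda).

Lemma ix1E a b : (ix a b).1.+1 = (if a < b then b - a else b + n - a)%N.
Proof.
rewrite /=; have := ltn_ord a; have := ltn_ord b.
case: (ltnP a b) => ab bn an; last by rewrite modn_small; lia.
have -> : (b + (n - a.+1) = (b - a).-1 + n)%N by lia.
by rewrite modnDr modn_small; lia.
Qed.

(* The middle index c for which the product of the entries (a, c) and (c, b)
   occurs in the differential of the entry (a, b) for every value of eps. *)
Definition straight a c b : bool :=
  (if a < b then (a < c) && (c < b) else (a < c) || (c < b))%N.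

(** The summation index l becomes the middle index c, equal to a + l modulo n; [straight] expresses
    l < i. *)
Lemma dLambda_gen_entry eps a b :
  dLambda_gen eps (ix a b) =
    \sum_c (if straight a c b then 1 else eps) *: (entry a c * entry c b).
Proof.
rewrite /dLambda_gen; set i := (ix a b).1.+1.
have i_le : (i <= n)%N by apply: ltn_ord.
transitivity (\sum_(1 <= l < n.+1) (if (l < i)%N then 1 else eps) *:
    (hgen F n l a.+1 * hgen F n (if l < i then i - l else i + n - l)%N (a.+1 + l)%N)).
  rewrite [RHS](big_cat_nat _ (n := i)) //=; last exact: leqW.
  congr (_ + _); first by apply: eq_big_nat => l /andP[_ ->]; rewrite scale1r.
  rewrite scaler_sumr; apply: eq_big_nat => l /andP[il _].
  by rewrite ltnNge il.
rewrite big_add1 big_mkord /=.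
have ix_bij : bijective (fun c : 'I_n => (ix a c).1).
  exists (fun j : 'I_n => tgt (j, a)) => [c|j] /=; first exact: (tgt_ix a c).
  by have := ixK (j, a) => /(congr1 fst).
rewrite (reindex (fun c : 'I_n => (ix a c).1)) /=; last exact: onW_bij.
apply: eq_bigr => c _; set l := (ix a c).1.+1.
have iE : i = (if a < b then b - a else b + n - a)%N by apply: ix1E.
have lE : l = (if a < c then c - a else c + n - a)%N by apply: ix1E.
have -> : (l < i)%N = straight a c b.
  have := ltn_ord a; have := ltn_ord b; have := ltn_ord c.
  rewrite iE lE /straight; case: (ltnP a b); case: (ltnP a c) => /=; lia.
congr (_ *: (_ * _)); first exact: (hgenE F (ix a c)).
rewrite -[RHS](hgenE F (ix c b)) ix1E.
have e : (ix c b).2.+1 = (a.+1 + l)%N %[mod n].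
  rewrite lE /=; have := ltn_ord a.
  case: (ltnP a c) => ac an; first by congr (_ %% _)%N; lia.
  by rewrite -(modnDr c.+1); congr (_ %% _)%N; lia.
rewrite [RHS](hgen_mod _ _ e).
congr hgen; have := ltn_ord a; have := ltn_ord b; have := ltn_ord c.
rewrite iE lE /straight.
by case: (ltnP a b); case: (ltnP a c); case: (ltnP c b) => /=; lia.
Qed.

Definition height t : int := if up t then (tgt t)%:Z - (src t)%:Z else 0.

Lemma up_sign_ix a b :
  up_sign (ix a b) = if (a < b)%N then 1 else if (b < a)%N then -1 else 0.
Proof. by rewrite /up_sign up_ix tgt_ix. Qed.

Lemma height_ix a b : height (ix a b) = if (a < b)%N then b%:Z - a%:Z else 0.
Proof. by rewrite /height up_ix tgt_ix. Qed.

Lemma full_wt_ix a b : full_wt (ix a b) = basis_wt a - basis_wt b.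
Proof. by rewrite /full_wt tgt_ix. Qed.

(** Height is constrained only in the leading degree m: the levels descend from filtration m at h =
    0 to filtration m - 1 at large h. *)
Definition level_pred (k m h : int) : pred {set index} := fun S =>
  [&& #|S|%:Z == k, wsum (@full_wt n) S == 0, wsum (@up_sign n) S <= m &
      (wsum (@up_sign n) S == m) ==> (h <= wsum height S)].

Definition level k m h : {vspace Lambda} := ext_span F (level_pred k m h).

Definition critical_fil (k m : int) : {vspace Lambda} := level k m 0.

Lemma height_ge0 S : 0 <= wsum height S.
Proof.
apply: sumr_ge0 => t _; rewrite /height; case: ifP => // ut.
by rewrite subr_ge0 lez_nat ltnW.
Qed.

Lemma critical_filP k m S : level_pred k m 0 S =
  [&& #|S|%:Z == k, wsum (@full_wt n) S == 0 & wsum (@up_sign n) S <= m].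
Proof. by rewrite /level_pred height_ge0 implybT !andbT. Qed.

Definition product_pred (t : index) (i j : int) : pred {set index} := fun U =>
  [&& #|U| == 2%N, wsum (@full_wt n) U == full_wt t,
      wsum (@up_sign n) U <= up_sign t + i & height t + j <= wsum height U].

Lemma level_deriv (G : index -> Lambda) i j k m h x :
  (forall t, G t \in ext_span F (product_pred t i j)) ->
  x \in level k m h -> ext_deriv G x \in level (k + 1) (m + i) (h + j).
Proof.
move=> GP; apply: (ext_deriv_span GP) => s S U sS.
case/and4P=> /eqP Sk /eqP Sf Sm /implyP Sh /and4P[/eqP U2 /eqP Uf Um Uh] dUS.
have wS (M : zmodType) (g : index -> M) : wsum g (s |: S) = g s + wsum g S.
  by rewrite /wsum big_setU1.
rewrite /level_pred !wsumU // cardsU disjoint_setI0 // cards0 subn0 U2.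
rewrite !wS in Sf Sm Sh; rewrite Uf Sf eqxx /=.
have -> /= : (2 + #|S|)%N%:Z == k + 1
  by move: Sk; rewrite cardsU1 sS => <-; rewrite add1n -addn1 -PoszD eqz_nat addnAC addnC.
apply/andP; split; first lia.
apply/implyP => /eqP e; have H0 : up_sign s + wsum (@up_sign n) S = m by lia.
have := Sh (introT eqP H0); lia.
Qed.

Lemma entry2_span a c b i j :
  up_sign (ix a c) + up_sign (ix c b) <= up_sign (ix a b) + i ->
  height (ix a b) + j <= height (ix a c) + height (ix c b) ->
  entry a c * entry c b \in ext_span F (product_pred (ix a b) i j).
Proof.
move=> us ht; have [acb|acb] := eqVneq (ix a c) (ix c b).
  by rewrite /entry acb ext_gen_sq mem0v.
apply: (ext_spanM (P := pred1 [set ix a c]) (Q := pred1 [set ix c b])).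
- move=> S T /eqP -> /eqP -> dST; rewrite /product_pred !wsumU // !wsum1 us ht.
  by rewrite cards2 acb !full_wt_ix addrA subrK !eqxx.
- by apply: ext_gen_span => /=.
- by apply: ext_gen_span => /=.
Qed.

Definition lowered_gen t : Lambda := if up t then 0 else dLambda_gen 0 t.

(** A straight product for a generator that is not up contains an up entry, which increases the
    height. *)
Lemma lowered_gen_span t : lowered_gen t \in ext_span F (product_pred t 1 1).
Proof.
rewrite /lowered_gen -(ixK t) up_ix; move: (src t) (tgt t) => a b.
case: ltnP => ab; first exact: mem0v.
rewrite dLambda_gen_entry; apply: memv_suml => c _.
case: ifP => [st|_]; last by rewrite scale0r mem0v.
rewrite scale1r; apply: entry2_span; rewrite ?up_sign_ix ?height_ix;
  move: st; rewrite /straight; case: (ltngtP a b) ab => //= ab _ st;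
  case: (ltngtP a c) st => ac /= st; case: (ltngtP c b) st => cb /= st; lia.
Qed.

Lemma dLambda0_split x :
  dLambda n (0 : F) x = up_diff F n x + ext_deriv lowered_gen x.
Proof.
rewrite /dLambda /up_diff !lfunE /= /ext_deriv_fun -big_split /=.
apply: eq_bigr => t _; rewrite -mulrDl; congr (_ * _).
rewrite /lowered_gen; case: ifP => [ut|nut]; rewrite ?addr0.
  rewrite -{1}(ixK t) dLambda_gen_entry /up_diff_gen; apply: eq_bigr => c _.
  rewrite /straight /upper -/(up t) ut.
  by do 2!case: ltnP => _; rewrite /= ?scale0r ?scale1r ?mul0r ?mulr0.
by rewrite /up_diff_gen upper_diff ?add0r //; apply: negbT.
Qed.

Lemma up_diff_level k m h x :
  x \in level k m h -> up_diff F n x \in level (k + 1) (m + 1) h.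
Proof.
rewrite -[h in X in _ -> X]addr0; apply: level_deriv => t; apply: memv_suml => c _.
rewrite -(ixK t) src_ix tgt_ix /upper; move: (src t) (tgt t) => a b.
case: ltnP => ac; last by rewrite mul0r mem0v.
case: ltnP => cb; last by rewrite mulr0 mem0v.
by apply: entry2_span; rewrite ?up_sign_ix ?height_ix ac cb (ltn_trans ac cb); lia.
Qed.

(** The terms of d_1 absent from d_0: [bent_gen] has the middle indices other than row and column,
    [cartan_gen] collects those two. *)
Definition bent_gen t : Lambda :=
  \sum_(c | [&& ~~ straight (src t) c (tgt t), c != src t & c != tgt t])
    entry (src t) c * entry c (tgt t).

Definition cartan_gen t : Lambda :=
  (entry (src t) (src t) - entry (tgt t) (tgt t)) * ext_gen F t.

Lemma dLambda_gen_diff t :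
  dLambda_gen 1 t - dLambda_gen 0 t = bent_gen t + cartan_gen t.
Proof.
rewrite -(ixK t) !dLambda_gen_entry /bent_gen /cartan_gen src_ix tgt_ix.
move: (src t) (tgt t) => a b; rewrite -sumrB.
transitivity (\sum_(c | ~~ straight a c b) entry a c * entry c b).
  rewrite [RHS]big_mkcond; apply: eq_bigr => c _.
  by case: ifP => _; rewrite ?subrr // scale1r scale0r subr0.
have [<-|ab] := eqVneq a b.
  rewrite subrr mul0r addr0 (bigD1 a) /=; last by rewrite /straight ltnn.
  rewrite /entry ext_gen_sq add0r; apply: eq_bigl => c.
  by rewrite andbb.
have ab' : a != b :> nat by [].
rewrite (bigD1 a) /=; last by rewrite /straight ltnn; case: ltngtP ab'.
rewrite (bigD1 b) /=; last first.
  rewrite /straight ltnn eq_sym ab.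
  by case: ltngtP ab' => //= *; rewrite ?andbF //; lia.
rewrite addrA addrC; congr (_ + _).
  by apply: eq_bigl => c; rewrite andbA.
by rewrite mulrBl; congr (_ + _); apply: ext_gen_anti.
Qed.

Lemma bent_gen_span t : bent_gen t \in ext_span F (product_pred t (-1) 0).
Proof.
rewrite /bent_gen -(ixK t) src_ix tgt_ix; move: (src t) (tgt t) => a b.
apply: memv_suml => c /and3P[st ca cb].
have ca' : c != a :> nat by []. have cb' : c != b :> nat by [].
apply: entry2_span; rewrite ?up_sign_ix ?height_ix; move: st; rewrite /straight;
  case: (ltngtP a b) => //= ab; case: (ltngtP a c) ca' => //= ac _;
  case: (ltngtP c b) cb' => //= lt_cb _ _; lia.
Qed.

(* On a product of entries of total weight zero, the bracket with the diagonal
   entries multiplies by that weight. *)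
Lemma cartan_eq0 k m h x : x \in level k m h -> ext_deriv cartan_gen x = 0.
Proof.
move: x; apply: ext_span_ind => [|a x y Ex Ey|S /and4P[_ /eqP Sf _ _]].
- exact: linear0.
- by rewrite linearP /= Ex Ey scaler0 addr0.
rewrite lfunE /= /ext_deriv_fun.
have E s : cartan_gen s * ext_contr s (ext_mono F S) = if s \in S then
    (entry (src s) (src s) - entry (tgt s) (tgt s)) * ext_mono F S else 0.
  rewrite /cartan_gen -mulrA.
  have -> : ext_gen F s * ext_contr s (ext_mono F S)
      = if s \in S then ext_mono F S else 0.
    apply/ffunP => U; rewrite gen_mul_contr; have [->|US] := eqVneq U S.
      by case: ifP => _; rewrite ?ffunE.
    by case: ifP => _; case: ifP => _; rewrite !ffunE ?(negPf US).
  by case: ifP; rewrite ?mulr0.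
under eq_bigr => s _ do rewrite E.
rewrite -big_mkcond -mulr_suml.
have -> : \sum_(s in S) (entry (src s) (src s) - entry (tgt s) (tgt s)) =
    \sum_v (wsum (@full_wt n) S v)%:~R *: entry v v.
  under [RHS]eq_bigr => v _ do
    rewrite wsum_ffun /wsum rmorph_sum scaler_suml.
  rewrite exchange_big; apply: eq_bigr => s _ /=.
  under eq_bigr => v _ do rewrite !ffunE rmorphB scalerBl /= -!pmulrn.
  have D u : \sum_(v < n) ((v == u)%:R : F) *: entry v v = entry u u.
    rewrite (bigD1 u) //= eqxx scale1r big1 ?addr0 // => v /negPf ->.
    by rewrite scale0r.
  by rewrite sumrB !D.
by rewrite big1 ?mul0r // => v _; rewrite Sf ffunE scale0r.
Qed.

Lemma levelW k m m' x : m <= m' -> x \in critical_fil k m -> x \in critical_fil k m'.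
Proof.
move=> mm'; apply: ext_spanS => S; rewrite !critical_filP.
by case/and3P=> -> -> Sm; rewrite (le_trans Sm).
Qed.

Lemma critical_fil_diff k m x : x \in critical_fil k m ->
  dLambda n (1 : F) x - dLambda n (0 : F) x \in critical_fil (k + 1) (m - 1).
Proof.
move=> xF; have -> : dLambda n (1 : F) x - dLambda n 0 x = ext_deriv bent_gen x.
  rewrite -[RHS]addr0 -(cartan_eq0 xF) /dLambda !lfunE /= /ext_deriv_fun.
  rewrite -sumrB -big_split; apply: eq_bigr => t _ /=.
  by rewrite -mulrBl -mulrDl dLambda_gen_diff.
by have := level_deriv bent_gen_span xF; rewrite addr0.
Qed.

Lemma critical_fil_d k m x : x \in critical_fil k m ->
  dLambda n (0 : F) x \in critical_fil (k + 1) (m + 1).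
Proof.
move=> xF; rewrite dLambda0_split memvD ?up_diff_level //.
have := level_deriv lowered_gen_span xF; apply: ext_spanS => S.
by rewrite critical_filP /level_pred => /and4P[-> -> ->].
Qed.

Hypothesis nz : forall j, (0 < j < 3 * n)%N -> j%:R != 0 :> F.

(** Each nonzero component of [z] for [up_wt] has repeated scores by [balanced_noninjective], and is
    therefore a boundary. *)
Lemma up_diff_exact (m : int) z : m != 0 ->
  z \in ext_span F (fun S => (wsum (@full_wt n) S == 0) && (wsum (@up_sign n) S == m)) ->
  up_diff F n z = 0 -> exists y, up_diff F n y = z.
Proof.
move=> m0 zP az.
pose pi (c : {ffun 'I_n -> int}) : Lambda -> Lambda :=
  ext_proj (fun S => wsum (@up_wt n) S == c).
have zE : z = \sum_(c <- undup [seq wsum (@up_wt n) T | T : {set index}]) pi c z.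
  apply/ffunP => S; rewrite sum_ffunE.
  rewrite (bigD1_seq (wsum (@up_wt n) S)) ?undup_uniq //=; last first.
    by rewrite mem_undup; apply: image_f.
  by rewrite ffunE eqxx big1 ?addr0 // => c cS; rewrite ffunE eq_sym (negPf cS).
suff : z \in (limg (up_diff F n)) by move=> /memv_imgP[y _ ->]; exists y.
rewrite zE; apply: memv_suml => c _.
have [->|pz0] := eqVneq (pi c z) 0; first exact: mem0v.
have [S zS /eqP Sc] : exists2 S, z S != 0 & wsum (@up_wt n) S == c.
  apply/exists_inP; apply: contraR pz0 => /exists_inPn zS; apply/eqP/ffunP => S.
  rewrite !ffunE; case: ifP => // Sc; apply/eqP; apply: contraTT Sc => /zS.
  by [].
have ninj : ~ injective (score c).
  rewrite -Sc; move/ext_spanP/(_ S): zP => zP.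
  have /andP[/eqP Sf /eqP Sm] : (wsum (@full_wt n) S == 0) && (wsum (@up_sign n) S == m).
    by apply: contraR zS => /zP ->.
  by apply: balanced_noninjective; rewrite // Sm.
have [|y yE] := acyclic_noninjective nz ninj (ext_proj_span _ z).
  rewrite (homogeneous_proj _ _ (@up_diff_wt F n)) az /=.
  exact: (linear0 (ext_proj _)).
by rewrite /pi -yE memv_img ?memvf.
Qed.

Definition quad_wt t : int * {ffun 'I_n -> int} * int * int :=
  (1, full_wt t, up_sign t, height t).

Lemma wsum_quad S : wsum quad_wt S =
  (#|S|%:Z, wsum (@full_wt n) S, wsum (@up_sign n) S, wsum height S).
Proof.
have E1 : (wsum quad_wt S).1.1.1 = #|S|%:Z.
  by rewrite -(@wsum_morph _ _ _ quad_wt (fun q => q.1.1.1)) // /wsum sumr_const natz.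
have E2 : (wsum quad_wt S).1.1.2 = wsum (@full_wt n) S.
  by rewrite -(@wsum_morph _ _ _ quad_wt (fun q => q.1.1.2)).
have E3 : (wsum quad_wt S).1.2 = wsum (@up_sign n) S.
  by rewrite -(@wsum_morph _ _ _ quad_wt (fun q => q.1.2)).
have E4 : (wsum quad_wt S).2 = wsum height S.
  by rewrite -(@wsum_morph _ _ _ quad_wt (fun q => q.2)).
by move: E1 E2 E3 E4; case: (wsum quad_wt S) => [[[? ?] ?] ?] /= -> -> -> ->.
Qed.

Lemma up_diff_quad : homogeneous quad_wt (up_diff F n) (1, 0, 1, 0).
Proof.
apply: up_diff_homogeneous => a c b ac cb; rewrite /quad_wt !up_sign_ix !height_ix.
rewrite !full_wt_ix ac cb (ltn_trans ac cb).
congr (_, _, _, _) => /=; [by rewrite addr0 addrA subrK|].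
by rewrite addr0 addrC addrA subrK.
Qed.

(** The component [z] of sign m and height h is an [up_diff] cocycle, since the rest of d_0 raises
    the height. A primitive, projected to sign m - 1 and height h, removes [z] at the cost of
    greater height. *)
Lemma dLambda_level_exact k m h x : m != 0 -> x \in level k m h ->
  dLambda n (0 : F) x \in critical_fil (k + 1) m ->
  exists2 y, y \in critical_fil (k - 1) (m - 1) &
    x - dLambda n (0 : F) y \in level k m (h + 1).
Proof.
move=> m0 xL dxF.
pose q : int * {ffun 'I_n -> int} * int * int := (k, 0, m, h).
pose z := ext_proj (fun S => wsum quad_wt S == q) x.
have zP : z \in ext_span F (fun S => wsum quad_wt S == q) by apply: ext_proj_span.
have az : up_diff F n z = 0.
  rewrite (homogeneous_proj _ _ up_diff_quad).
  have -> : up_diff F n x = dLambda n 0 x - ext_deriv lowered_gen x.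
    by rewrite dLambda0_split addrK.
  rewrite (linearB (ext_proj _)) /=.
  have bL := level_deriv lowered_gen_span xL.
  rewrite (ext_proj_eq0 _ dxF) ?(ext_proj_eq0 _ bL) ?subrr // => S;
    rewrite wsum_quad => /eqP[Sk Sf Sm Sh]; rewrite /level_pred.
    by rewrite Sm Sh addr0 eqxx /= !negb_and; do 3!(apply/orP; right); rewrite gerDl.
  by rewrite Sm !negb_and; do 2!(apply/orP; right); rewrite gerDl.
have [y yz] : exists y, up_diff F n y = z.
  apply: up_diff_exact m0 _ az; apply: ext_spanS zP => S.
  by rewrite wsum_quad => /eqP[_ -> -> _]; rewrite !eqxx.
pose q' : int * {ffun 'I_n -> int} * int * int := (k - 1, 0, m - 1, h).
pose y' := ext_proj (fun S => wsum quad_wt S == q') y.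
have q'E : q' + (1, 0, 1, 0) = q.
  by congr (_, _, _, _); rewrite /= ?addr0 ?subrK.
have y'z : up_diff F n y' = z.
  by rewrite (homogeneous_proj _ _ up_diff_quad) q'E yz ext_proj_id.
have y'L : y' \in level (k - 1) (m - 1) h.
  apply: ext_spanS (ext_proj_span (fun S => wsum quad_wt S == q') y) => S.
  by rewrite wsum_quad /level_pred => /eqP[-> -> -> ->]; rewrite !eqxx !lexx implybT.
exists y'.
  by apply: ext_spanS y'L => S; rewrite critical_filP => /and4P[-> -> -> _].
rewrite dLambda0_split y'z opprD addrA memvB //; last first.
  by have := level_deriv lowered_gen_span y'L; rewrite !subrK.
apply/ext_spanP => S SL; rewrite /z !ffunE wsum_quad.
case: eqP => [_|Sq]; first exact: subrr.
rewrite subr0; move/ext_spanP: xL; apply; apply: contra SL.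
rewrite /level_pred => /and4P[/eqP Sk /eqP Sf Sm Sh].
rewrite Sk Sf Sm !eqxx /=; apply/implyP => Sm'; have := implyP Sh Sm'.
rewrite le_eqVlt => /orP[/eqP hE|]; last by lia.
by case: Sq; rewrite Sk Sf (eqP Sm') -hE.
Qed.

Lemma dLambda_gr_exact k m x : m != 0 -> x \in critical_fil k m ->
  dLambda n (0 : F) x \in critical_fil (k + 1) m ->
  exists2 y, y \in critical_fil (k - 1) (m - 1) &
    x - dLambda n (0 : F) y \in critical_fil k (m - 1).
Proof.
(* No set reaches height [top], so at that level nothing of sign m is left. *)
move=> m0; pose top := \sum_t height t + 1.
have height_ge t : 0 <= height t.
  by have := height_ge0 [set t]; rewrite /wsum big_set1.
have top_gt S : wsum height S < top.
  rewrite ltzD1 /wsum [leRHS](bigID (mem S)) /= lerDl.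
  by apply: sumr_ge0 => t _.
suff H j h : h + j%:Z = top -> x \in level k m h ->
    dLambda n (0 : F) x \in critical_fil (k + 1) m ->
    exists2 y, y \in critical_fil (k - 1) (m - 1) &
      x - dLambda n (0 : F) y \in critical_fil k (m - 1).
  apply: (H `|top|%N 0); rewrite add0r gez0_abs //.
  by have := top_gt set0; rewrite /wsum big_set0 => /ltW.
elim: j h x => [|j IHj] h x hj xL dxF.
  exists 0; rewrite ?mem0v // linear0 subr0.
  apply: ext_spanS xL => S; rewrite critical_filP => /and4P[-> -> Sm Sh] /=.
  have : wsum (@up_sign n) S != m.
    by apply/eqP => e; have := top_gt S; move: Sh; rewrite e eqxx /=; lia.
  lia.
have [y yF xyL] := dLambda_level_exact m0 xL dxF.
have [||y' y'F xyF] := IHj (h + 1) (x - dLambda n (0 : F) y) _ xyL.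
- by rewrite -hj -addrA.
- by rewrite linearB /= dLambda_sq0 subr0.
exists (y + y'); first by rewrite memvD.
by rewrite linearD /= opprD addrA.
Qed.

Lemma card_indices S : (#|S| <= n * n)%N.
Proof. by apply: leq_trans (max_card _) _; rewrite card_prod card_ord. Qed.

Lemma critical_fil_top k m :
  (critical_fil k m <= critical_fil k ((n * n).+1%:Z))%VS.
Proof.
apply/subvP => x; apply: ext_spanS => S; rewrite !critical_filP.
case/and3P=> -> -> _ /=; apply: le_trans (_ : #|S|%:Z <= _).
  rewrite /wsum -natz -sumr_const; apply: ler_sum => t _.
  by rewrite /up_sign; case: ifP => // _; case: ifP.
by rewrite lez_nat leqW // card_indices.
Qed.

Lemma critical_fil_bot k : critical_fil k (- (n * n).+1%:Z) = 0%VS.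
Proof.
apply/eqP; rewrite -subv0; apply/subvP => x /ext_spanP xF.
rewrite memv0; apply/eqP/ffunP => S; rewrite xF ?ffunE // critical_filP.
apply/negP => /and3P[_ _]; apply/negP; rewrite -ltNge.
apply: lt_le_trans (_ : - #|S|%:Z <= _).
  by rewrite ltrN2 ltz_nat ltnS card_indices.
rewrite /wsum -natz -sumr_const -sumrN; apply: ler_sum => t _.
by rewrite /up_sign; case: ifP => // _; case: ifP.
Qed.

Lemma critical_dim k :
  let Fil := @critical_fil in let N := (n * n).+1 in
  (\dim (cycles_top (dLambda n (0 : F)) Fil N k)
   + \dim (bounds_top (dLambda n (1 : F)) Fil N k)
   = \dim (cycles_top (dLambda n (1 : F)) Fil N k)
   + \dim (bounds_top (dLambda n (0 : F)) Fil N k))%N.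
Proof.
apply: dim_deform.
- exact: dLambda_sq0.
- exact: dLambda_sq0.
- by move=> j m m' mm'; apply/subvP => x; apply: levelW.
- exact: critical_fil_top.
- exact: critical_fil_bot.
- exact: critical_fil_d.
- exact: critical_fil_diff.
- exact: dLambda_gr_exact.
Qed.

End CriticalFiltration.

Theorem corollary3p6p3 (n p : nat) (n_gt0 : (0 < n)%N) (p_prime : prime p)
    (p_large : (2 * n ^ 2 < p)%N) :
  exists f : forall k : nat, {linear Hcc n (0 : 'F_p) k -> Hcc n (1 : 'F_p) k},
    forall k : nat, bijective (f k).
Proof.
have p3 : (3 * n <= p)%N by apply: leq_trans p_large; rewrite -mulnn; nia.
have nz j : (0 < j < 3 * n)%N -> j%:R != 0 :> 'F_p.
  case/andP=> j0 jn; rewrite -(dvdn_pcharf (pchar_Fp p_prime)).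
  by rewrite gtnNdvd //; apply: leq_trans jn _.
have np : (n + 2 <= p)%N by lia.
pose N := (n * n).+1.
(* Internal degree zero is torus weight zero, and signs are bounded by the number of generators,
   hence by N. *)
have ccE (k : nat) : cc _ n p k = critical_fil 'F_p n k N%:Z.
  apply/vspaceP => x; apply/idP/idP; apply: ext_spanS => S.
    rewrite mono_ideg_eq0 // critical_filP => /andP[/eqP -> ->] /=.
    rewrite eqxx /=; apply: le_trans (_ : #|S|%:Z <= _).
      rewrite /wsum -natz -sumr_const; apply: ler_sum => t _.
      by rewrite /up_sign; case: ifP => // _; case: ifP.
    by rewrite lez_nat leqW // card_indices.
  by rewrite mono_ideg_eq0 // critical_filP eqz_nat => /and3P[-> -> _].
have cocE (eps : 'F_p) (k : nat) : cocycles (dLambda n eps) (cc _ n p) k =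
    cycles_top (dLambda n eps) (critical_fil 'F_p n) N k.
  by rewrite /cocycles ccE.
have cobE (eps : 'F_p) (k : nat) : coboundaries (dLambda n eps) (cc _ n p) k =
    bounds_top (dLambda n eps) (critical_fil 'F_p n) N k.
  case: k => [|k]; rewrite /coboundaries /bounds_top; last first.
    by rewrite ccE; congr (_ @: critical_fil _ _ _ _)%VS; lia.
  (* For k = 0 the source of [bounds_top] sits in cohomological degree -1, where no set has the
     required cardinality. *)
  rewrite (_ : critical_fil _ _ _ _ = 0%VS) ?limg0 //.
  apply/eqP; rewrite -subv0; apply/subvP => x /ext_spanP xF.
  rewrite memv0; apply/eqP/ffunP => S; rewrite xF ?ffunE // critical_filP.
have H (k : nat) :
    {f : {linear Hcc n (0 : 'F_p) k -> Hcc n (1 : 'F_p) k} | bijective f}.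
  have bz (eps : 'F_p) := @cc_coboundaries 'F_p n p (prime_gt0 p_prime) eps k.
  refine (@cohomology_isom _ _ (dLambda n 0) (dLambda n 1) (cc _ n p) k _ _ _).
  - exact: bz.
  - exact: bz.
  (* Rewriting would try to unify [dLambda n 0] with [dLambda n 1]. *)
  have dims (eps eps' : 'F_p) :
      (\dim (cocycles (dLambda n eps) (cc _ n p) k)
       + \dim (coboundaries (dLambda n eps') (cc _ n p) k)
       = \dim (cycles_top (dLambda n eps) (critical_fil 'F_p n) N k)
       + \dim (bounds_top (dLambda n eps') (critical_fil 'F_p n) N k))%N.
    by rewrite cocE cobE.
  exact: etrans (dims 0 1) (etrans (critical_dim nz k) (esym (dims 1 0))).
by exists (fun k => sval (H k)) => k; apply: (svalP (H k)).
Qed.
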